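(* Let $k$ be an algebraically closed field of characteristic zero. Define regular functions $p,F,r,G\in k[x,y,z]=\mathcal{O}(\mathbb{A}_k^3)$ by $$p=xz-y^2,\quad F=xz-y^3,\quad r=yF-x,\quad G=x^{-1}(F^4+r^3).$$ (a) Every fiber of $p$ and of $G$ (as morphisms $\mathbb{A}^3_k\to\mathbb{A}^1_k$) other than the zero fiber is isomorphic to $Y=SL_2(k)/T$, where $T\subset SL_2(k)$ is the one-dimensional torus. (b) Every fiber of $p$ is normal. (c) The zero fiber of $G$ is not normal. Consequently, there is no algebraic automorphism of $\mathbb{A}_k^3$ which carries the hypersurface $G=1$ to the hypersurface $p=1$.
   Context: $F^4+r^3$ is divisible by $x$ in $k[x,y,z]$, so $G$ is a polynomial. $T$ is the subgroup of diagonal matrices in $SL_2(k)$ and $Y$ is the quotient variety. *)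

(* Defs.v *)
From HB Require Import structures.
From mathcomp Require Import all_boot all_algebra.
From mathcomp Require Import fraction ring_quotient.
From mathcomp Require Import boolp classical_sets.
From mathcomp Require Import mpoly.
From mathcomp Require Import ring.

Set Implicit Arguments.
Unset Strict Implicit.
Unset Printing Implicit Defensive.

Import GRing.Theory.

Local Open Scope classical_set_scope.
Local Open Scope ring_scope.

(* Closed points of affine n-space over an algebraically closed k are row
   vectors; g.@[v 0] is the value of the polynomial g at v : 'rV[k]_n.        *)

(** * Varieties as spaces with functions *)

(* A set with a family of open subsets and, for each open U, the k-valued
   functions that are regular on U.  Functions are total; membership of f in
   [regular U] only depends on the restriction of f to U in all the instances
   below.                                                                     *)
Record funspace (k : fieldType) := FunSpace {
  point :> Type;
  open_in : set (set point);
  regular : set point -> set (point -> k)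
}.

Section Embedded.
Variables (k : fieldType) (n : nat) (T : Type) (iota : T -> 'rV[k]_n).

(* The Zariski topology and the regular functions (locally quotients of
   polynomials) induced on T by an injection iota of T into affine n-space.   *)
Definition zariski_open (U : set T) : Prop :=
  exists E : set {mpoly k[n]},
    U = [set t | exists2 g, E g & g.@[iota t 0] != 0].

Definition zariski_regular (U : set T) (f : T -> k) : Prop :=
  forall t, U t -> exists (W : set T) (a b : {mpoly k[n]}),
    [/\ zariski_open W, W t, W `<=` U &
        forall s, W s -> b.@[iota s 0] != 0 /\
                         f s = a.@[iota s 0] / b.@[iota s 0]].

Definition embedded_space : funspace k :=
  FunSpace zariski_open zariski_regular.
End Embedded.

Definition isomorphic (k : fieldType) (X Y : funspace k) : Prop :=
  exists phi : X -> Y,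
    [/\ bijective phi,
        forall U : set Y, open_in U <-> open_in (phi @^-1` U) &
        forall (U : set Y) (f : Y -> k), open_in U ->
          (regular U f <-> regular (phi @^-1` U) (f \o phi))].

(** * The quotient variety SL_2 / T *)

Section SL2.
Variable k : fieldType.

Definition SL2 : Type := {g : 'M[k]_2 | \det g == 1}.

Definition SL2_space : funspace k :=
  embedded_space (fun g : SL2 => mxvec (val g)).

Definition torus : set SL2 := [set t | is_diag_mx (val t)].

Definition torus_coset (g : SL2) : set SL2 :=
  [set h | exists2 t, torus t & val h = val g *m val t].

Definition SL2modT : Type := {C : set SL2 | exists g, C = torus_coset g}.

Definition SL2modT_pi (g : SL2) : SL2modT :=
  exist _ (torus_coset g) (ex_intro _ g erefl).

(* Quotient topology; a function on U is regular when its pullback to the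
   preimage of U in SL_2 is.                                                  *)
Definition SL2modT_space : funspace k :=
  @FunSpace k SL2modT
    (fun U => @open_in k SL2_space (SL2modT_pi @^-1` U))
    (fun U f => @regular k SL2_space (SL2modT_pi @^-1` U) (f \o SL2modT_pi)).
End SL2.

(** * Fibres *)

Section Fibers.
Variables (k : fieldType) (n : nat) (f : {mpoly k[n]}) (c : k).

(* The fibre of f over c is the closed subscheme of affine n-space with
   coordinate ring k[x_1, .., x_n] / (f - c).                                 *)
Definition fiber_ideal : set {mpoly k[n]} :=
  [set g | exists h, g = h * (f - c%:MP)].

Definition fiber_reduced : Prop :=
  forall (g : {mpoly k[n]}) (m : nat),
    fiber_ideal (g ^+ m) -> fiber_ideal g.

Definition fiber_points : Type := {v : 'rV[k]_n | f.@[v 0] == c}.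

Definition fiber_space : funspace k :=
  embedded_space (fun v : fiber_points => val v).

(* A scheme of finite type over an algebraically closed field is isomorphic to
   (the scheme attached to) a variety Y iff it is reduced and its space of
   closed points, with its regular functions, is isomorphic to Y.             *)
Definition fiber_isomorphic_to (Y : funspace k) : Prop :=
  fiber_reduced /\ isomorphic fiber_space Y.
End Fibers.

(** * Normality *)

Definition integrally_closed (B : idomainType) : Prop :=
  forall u : {fraction B},
    integralOver (@tofrac B) u -> exists b : B, u = tofrac b.

(* rho : R -> B presents B as the localization of R / I at its prime P / I:
   the local ring of Spec (R / I) at the point P.                             *)
Definition is_local_ring (R : comNzRingType) (I : set R) (P : prime_idealr R)
    (B : comUnitRingType) (rho : {rmorphism R -> B}) : Prop :=
  [/\ forall s, s \notin (P : pred R) -> rho s \is a GRing.unit,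
      forall b, exists a s, s \notin (P : pred R) /\ b = rho a / rho s &
      forall a, rho a = 0 <-> exists2 s, s \notin (P : pred R) & I (s * a)].

(* Spec (R / I) is normal: all its local rings are integrally closed domains. *)
Definition normal_quotient (R : comNzRingType) (I : set R) : Prop :=
  forall P : prime_idealr R, (forall a, I a -> a \in (P : pred R)) ->
    exists (B : idomainType) (rho : {rmorphism R -> B}),
      is_local_ring I P rho /\ integrally_closed B.

Definition fiber_normal (k : fieldType) (n : nat) (f : {mpoly k[n]}) (c : k) :=
  normal_quotient (fiber_ideal f c).

(** * Automorphisms of affine space *)

Definition polynomial_map (k : fieldType) (m n : nat)
    (phi : 'rV[k]_m -> 'rV[k]_n) : Prop :=
  exists P : 'I_n -> {mpoly k[m]}, forall v, phi v = \row_i (P i).@[v 0].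

Definition algebraic_automorphism (k : fieldType) (n : nat)
    (phi : 'rV[k]_n -> 'rV[k]_n) : Prop :=
  polynomial_map phi /\
  exists psi : 'rV[k]_n -> 'rV[k]_n,
    [/\ polynomial_map psi, cancel phi psi & cancel psi phi].

Definition hypersurface (k : fieldType) (n : nat) (f : {mpoly k[n]}) (c : k) :
  set 'rV[k]_n := [set v | f.@[v 0] = c].

(** * The polynomials *)

Section Polynomials.
Variable k : fieldType.

Definition x : {mpoly k[3]} := 'X_(0 : 'I_3).
Definition y : {mpoly k[3]} := 'X_(1 : 'I_3).
Definition z : {mpoly k[3]} := 'X_(2 : 'I_3).

Definition p : {mpoly k[3]} := x * z - y ^+ 2.
Definition F : {mpoly k[3]} := x * z - y ^+ 3.
Definition r : {mpoly k[3]} := y * F - x.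

(* x^{-1} (F^4 + r^3) is a polynomial; it is unique since k[x, y, z] is a
   domain.                                                                    *)
Lemma G_exists : exists G : {mpoly k[3]}, x * G = F ^+ 4 + r ^+ 3.
Proof.
exists (x ^+ 3 * z ^+ 4 - 4 * x ^+ 2 * z ^+ 3 * y ^+ 3
        + 6 * x * z ^+ 2 * y ^+ 6 - 4 * z * y ^+ 9
        - x ^+ 2 * (1 - y * z) ^+ 3 - 3 * x * (1 - y * z) ^+ 2 * y ^+ 4
        - 3 * (1 - y * z) * y ^+ 8).
by rewrite /r /F; ring.
Qed.
End Polynomials.

(* Main.v *)
Require Import Defs.
From HB Require Import structures.
From mathcomp Require Import all_boot all_algebra.
From mathcomp Require Import fraction ring_quotient generic_quotient.
From mathcomp Require Import boolp classical_sets mpoly.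
From mathcomp Require Import ring.

Set Implicit Arguments.
Unset Strict Implicit.
Unset Printing Implicit Defensive.

Import GRing.Theory.

Local Open Scope classical_set_scope.
Local Open Scope ring_scope.

(** The surface xz = y^2 + c with c <> 0 is the quotient SL_2 / T: the
    invariants of the right action of T, which scales the two columns of a
    matrix by inverse factors, are the products ab, ad, bc, cd of an entry of
    the first column and one of the second, and since ad - bc = 1 the pair
    (ad, bc) is given by ad + bc alone.  These invariants separate cosets
    ([quadric_quot_coset]), and the quotient map has a section over each of the
    open sets ad <> 0 and bc <> 0, which cover SL_2 / T ([quadric_quot_split]);
    so open sets and regular functions descend ([split_open],
    [split_regular]).

    The other fibres reduce to these.  Put V = z F^2 - 2 y^2 F + x y.  Then
    G = F V - r^2 identically, which means that G is the composite of p with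
    the polynomial map (F, r, V) of A^3.  On G = c with c <> 0 this map is
    inverted by a polynomial map, because c x = F^4 + r^3, c y = F^3 + r V and
    c^2 z = F^5 + 3 F^2 r V - F r^3 + V^3 there ([pullback_identities],
    [G_isomorphic_quadric]).

    Reducedness follows from the Nullstellensatz for the fibres.  Modulo p - c
    each polynomial has a unique normal form a(x,z) + b(x,z) y; if it vanishes
    on the surface, the choice of either square root y of xz - c forces
    a = b = 0 ([quadric_nullstellensatz]).

    The fibres of p are normal because k[x,z][sqrt(xz - c)] is integrally
    closed: xz - c is squarefree and k[x,z] is completely integrally closed.
    This stronger property passes from D to D[X] ([poly_cic]) and to a
    squarefree quadratic extension ([quad_cic]) by short arguments without
    unique factorization, and it implies integral closedness, which passes to
    the local rings ([local_ring_integrally_closed]).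

    The fibre G = 0 is singular along the z-axis.  As F^4 + r^3 = 0 there, r/F
    is a root of X^3 + F, hence integral.  It is not in the local ring of the
    axis: F, r and G vanish along x = xi t^4, y = t, z = z0 to the orders 3, 4
    and 8, and a relation s r = a F modulo G makes the coefficient of t in a,
    which does not depend on xi, equal to (1 + xi) s(0, 0, z0); so s vanishes
    at (0, 0, z0) ([curve_relation], [G_not_normal]).

    An automorphism that carries G = 1 to p = 1 pulls p - 1 back to a multiple
    of G - 1, and conversely, by the Nullstellensatz, so to l (G - 1) with a
    constant l <> 0.  It then identifies G = 0 with p = 1 - l, one of which is
    normal and the other not ([no_automorphism]). *)

(** * Complete integral closedness *)

(** Divisibility in an arbitrary commutative ring; [fiber_ideal f c g] unfolds
    to [rdvd (f - c%:MP) g]. *)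
Definition rdvd (A : comNzRingType) (a b : A) := exists q, b = q * a.

Lemma rdvdMl (A : comNzRingType) (a b c : A) : rdvd a b -> rdvd a (c * b).
Proof. by case=> q ->; exists (c * q); rewrite mulrA. Qed.

Lemma rdvdD (A : comNzRingType) (a b c : A) :
  rdvd a b -> rdvd a c -> rdvd a (b + c).
Proof. by move=> [q ->] [q' ->]; exists (q + q'); rewrite mulrDl. Qed.

Lemma rdvdMM (A : comNzRingType) (a b c d : A) :
  rdvd a b -> rdvd c d -> rdvd (a * c) (b * d).
Proof. by move=> [q ->] [q' ->]; exists (q * q'); rewrite mulrACA. Qed.

Lemma rdvd_sum (A : comNzRingType) (a : A) n (E : 'I_n -> A) :
  (forall i, rdvd a (E i)) -> rdvd a (\sum_i E i).
Proof.
move=> E_dvd; elim/big_rec: _ => [|i b _]; first by exists 0; rewrite mul0r.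
exact: rdvdD.
Qed.

Lemma rdvd_mul2r (A : idomainType) (a b c : A) :
  c != 0 -> rdvd (a * c) (b * c) -> rdvd a b.
Proof.
by move=> c0 [q]; rewrite mulrA => /(mulIf c0) ->; exists q.
Qed.

(** Every power of the fraction a/b lies in A once multiplied by w; stated by
    divisibility to stay inside A. *)
Definition almost_integral (A : comNzRingType) (b w a : A) :=
  forall n, rdvd (b ^+ n) (w * a ^+ n).

(** The binomial expansion of w^2 (a1 + a2)^n: each term is a product of
    w a1^(n-i), divisible by b^(n-i), and w a2^i, divisible by b^i. *)
Lemma almost_integralD (A : comNzRingType) (b w a1 a2 : A) :
  almost_integral b w a1 -> almost_integral b w a2 ->
  almost_integral b (w ^+ 2) (a1 + a2).
Proof.
move=> ai1 ai2 n; rewrite exprDn mulr_sumr; apply: rdvd_sum => i.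
rewrite mulrnAr -mulr_natl; apply: rdvdMl; rewrite expr2 mulrACA.
have -> : b ^+ n = b ^+ (n - i) * b ^+ i by rewrite -exprD subnK // -ltnS.
exact: rdvdMM.
Qed.

Lemma almost_integralMl (A : comNzRingType) (b w a c : A) :
  almost_integral b w a -> almost_integral b w (c * a).
Proof. by move=> ai n; rewrite exprMn mulrCA; apply: rdvdMl. Qed.

Lemma almost_integral0 (A : idomainType) (w a : A) :
  w != 0 -> almost_integral 0 w a -> rdvd 0 a.
Proof.
move=> w0 /(_ 1%N)[q /eqP]; rewrite !expr1 mulr0 mulf_eq0 (negbTE w0) => /eqP ->.
by exists 0; rewrite mul0r.
Qed.

Definition completely_integrally_closed (A : comNzRingType) :=
  forall a b w : A, w != 0 -> almost_integral b w a -> rdvd b a.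

Lemma field_cic (K : fieldType) : completely_integrally_closed K.
Proof.
move=> a b w w0; have [->|b0 _] := eqVneq b 0; first exact: almost_integral0.
by exists (a / b); rewrite divfK.
Qed.

Section PolyCic.
Import Pdiv.Idomain.
Variable D : idomainType.
Hypothesis cicD : completely_integrally_closed D.

(** The leading coefficients give an almost integral fraction of D, so c divides
    lead_coef q.  The rest of q is the difference of two almost integral
    elements, with w^2 in place of w. *)
Lemma almost_integral_scalar (w q : {poly D}) (c : D) :
  w != 0 -> almost_integral c%:P w q -> rdvd c%:P q.
Proof.
move=> w0; have [m] := ubnP (size q); elim: m w w0 q => // m IHm w w0 q ltqm ai.
have [->|q0] := eqVneq q 0; first by exists 0; rewrite mul0r.
have [l def_l] : rdvd c (lead_coef q).
  apply: (cicD (w := lead_coef w)); first by rewrite lead_coef_eq0.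
  move=> n; have [h] := ai n.
  rewrite -polyC_exp => /(congr1 lead_coef).
  by rewrite !lead_coefM lead_coef_exp lead_coefC => ->; exists (lead_coef h).
pose t := l *: 'X^((size q).-1).
have def_q : q = (q - t * c%:P) + t * c%:P by rewrite subrK.
suff [h def_h] : rdvd c%:P (q - t * c%:P).
  by rewrite def_q def_h -mulrDl; exists (h + t).
have def_t : t * c%:P = lead_coef q *: 'X^((size q).-1).
  by rewrite /t mulrC mul_polyC scalerA mulrC -def_l.
have lt_sz : (size (q - t * c%:P)%R < size q)%N.
  rewrite [X in (_ < X)%N]polySpred // ltnS; apply/leq_sizeP => j lej.
  rewrite def_t coefB coefZ coefXn; case: eqVneq => [->|nej].
    by rewrite mulr1 -lead_coefE subrr.
  rewrite mulr0 subr0 nth_default //.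
  by rewrite polySpred // ltn_neqAle eq_sym nej.
apply: (IHm (w ^+ 2)); rewrite ?expf_neq0 //; first exact: leq_trans lt_sz ltqm.
apply: almost_integralD ai _ => n.
by rewrite -mulNr exprMn mulrA; exists (w * (- t) ^+ n).
Qed.

(** Over the fraction field of D (pseudo-division) the reduced denominator b'
    of a/b satisfies b'^n | w for all n, and is therefore constant.  What
    remains is a denominator in D. *)
Lemma poly_cic : completely_integrally_closed {poly D}.
Proof.
move=> a b w w0.
have [->|b0 ai] := eqVneq b 0; first exact: almost_integral0.
have b_dvd_a : b %| a.
  have nz : (a != 0) || (b != 0) by rewrite b0 orbT.
  have g0 : gcdp a b != 0 by rewrite gcdp_eq0 negb_and.
  have := coprimep_div_gcd nz.
  have := divpK (dvdp_gcdl a b); have := divpK (dvdp_gcdr a b).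
  set g := gcdp a b; set a' := a %/ g; set b' := b %/ g.
  set ca := _ ^+ scalp a g; set cb := _ ^+ scalp b g => def_b def_a co_ab.
  have ca0 : ca != 0 by rewrite expf_neq0 ?lead_coef_eq0.
  have cb0 : cb != 0 by rewrite expf_neq0 ?lead_coef_eq0.
  suff sz1 : size b' = 1%N.
    rewrite -(dvdpZl _ _ cb0) -def_b -(dvdpZr _ _ ca0) -def_a.
    rewrite dvdp_mul2r // (eqp_dvdl _ (_ : b' %= 1)) ?dvd1p //.
    by rewrite -size_poly_eq1 sz1.
  have b'_dvd_w : b' ^+ size w %| w.
    have [e def_e] := ai (size w).
    have : (b' * g) ^+ size w %| w * (a' * g) ^+ size w.
      rewrite def_a def_b !exprZn -scalerAr (dvdpZl _ _ (expf_neq0 _ cb0)).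
      by rewrite (dvdpZr _ _ (expf_neq0 _ ca0)) def_e dvdp_mulIr.
    rewrite !exprMn mulrA dvdp_mul2r ?expf_neq0 //.
    by rewrite Gauss_dvdpl // coprimep_expl // coprimep_expr // coprimep_sym.
  have b'0 : b' != 0.
    by apply: contra_neq b0 => b'0; move/eqP: def_b;
       rewrite b'0 mul0r eq_sym scale_poly_eq0 (negbTE cb0) => /eqP.
  have := dvdp_leq w0 b'_dvd_w; rewrite [X in (X <= _)%N]polySpred ?expf_neq0 //.
  rewrite size_exp (polySpred b'0); case: (size b').-1 => // m.
  by rewrite mulSn leqNgt ltnS leq_addr.
(* Pseudo-divisibility only gives c a = q b with c in D: clear c from q. *)
have /dvdpP[[c q] /= c0 def_ca] := b_dvd_a; rewrite -mul_polyC in def_ca.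
have [h def_q] : rdvd c%:P q.
  apply: (almost_integral_scalar w0) => n; have [e def_e] := ai n.
  exists e; apply: (mulIf (expf_neq0 n b0)).
  by rewrite -mulrA -exprMn -def_ca exprMn mulrCA def_e mulrCA mulrA.
have cP0 : c%:P != 0 by rewrite polyC_eq0.
exists h; apply: (mulfI cP0).
by rewrite def_ca def_q mulrCA mulrA.
Qed.
End PolyCic.

(** * Integral closedness and localization *)

Local Notation "a %:F" := (@tofrac _ a) : ring_scope.

Lemma fraction_repr (A : idomainType) (u : {fraction A}) :
  exists n d : A, d != 0 /\ u = n%:F / d%:F.
Proof.
elim/quotW: u => -[[n d] /= d0]; exists n, d; split => //.
apply: (@mulIf _ d%:F); first by rewrite tofrac_eq0.
rewrite divfK ?tofrac_eq0 //; unlock tofrac; rewrite -[LHS]FracField.pi_mul.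
apply/eqmodP; rewrite /= FracField.equivfE /FracField.mulf /=.
by rewrite !numden_Ratio ?mulr1 ?oner_neq0 // mulrC.
Qed.

Lemma clear_denominator (K : fieldType) (a b c : K) i n :
  b != 0 -> (i <= n)%N -> b ^+ n * (c * (a / b) ^+ i) = c * a ^+ i * b ^+ (n - i).
Proof.
move=> b0 le_in; rewrite -[in LHS](subnK le_in) exprD expr_div_n mulrC -!mulrA.
by rewrite [_^-1 * _]mulrCA mulVf ?mulr1 // expf_neq0.
Qed.

(** If u = a/b is a root of a monic polynomial of degree n, each u^m is a
    combination of 1, u, .., u^(n-1), so b^n is a common denominator of all
    powers of u. *)
Lemma cic_integrally_closed (A : idomainType) :
  completely_integrally_closed A -> integrally_closed A.
Proof.
move=> cicA u [q q_monic qu0].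
have [a [b [b0 def_u]]] := fraction_repr u.
have bF0 : b%:F != 0 by rewrite tofrac_eq0.
suff [e def_a] : rdvd b a.
  by exists e; rewrite def_u def_a rmorphM mulfK.
pose n := (size q).-1.
apply: (cicA _ _ (b ^+ n)); first exact: expf_neq0.
move=> m; pose t := Pdiv.Ring.rmodp 'X^m q.
have um : u ^+ m = (map_poly (@tofrac A) t).[u].
  have := Pdiv.RingMonic.rdivp_eq q_monic 'X^m.
  move/(congr1 (fun s => (map_poly (@tofrac A) s).[u])).
  rewrite map_polyXn hornerXn => ->; rewrite rmorphD rmorphM /= hornerD hornerM.
  by rewrite (rootP qu0) mulr0 add0r.
have szt : (size t <= n)%N.
  rewrite -ltnS prednK; last by rewrite size_poly_gt0 monic_neq0.
  by rewrite Pdiv.Ring.ltn_rmodp monic_neq0.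
exists (\sum_(i < n) t`_i * a ^+ i * b ^+ (n - i)).
apply/eqP; rewrite -tofrac_eq !rmorphM !rmorphXn /= -[a%:F](divfK bF0) -def_u.
rewrite exprMn um mulrA; apply/eqP; congr (_ * _).
rewrite (@horner_coef_wide _ n) ?mulr_sumr; last first.
  by rewrite (leq_trans (size_poly _ _)).
rewrite rmorph_sum /=; apply: eq_bigr => i _.
by rewrite !rmorphM !rmorphXn /= def_u coef_map clear_denominator // ltnW.
Qed.

(** Units decided classically make any commutative ring a [comUnitRingType]. *)
Section ClassicalUnits.
Variable A : comNzRingType.

Definition has_inverse : {pred A} := fun a => `[< exists b, b * a = 1 >].

Definition classical_inverse (a : A) : A :=
  if pselect (exists b, b * a = 1) is left ex then sval (cid ex) else a.

Lemma mul_classical_inverse :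
  {in has_inverse, left_inverse 1 classical_inverse *%R}.
Proof.
move=> a /asboolP ex; rewrite /classical_inverse.
by case: pselect => // ex'; case: cid.
Qed.

Lemma has_inverseP (a b : A) : b * a = 1 -> has_inverse a.
Proof. by move=> ba1; apply/asboolP; exists b. Qed.

Lemma classical_inverse_out : {in [predC has_inverse], classical_inverse =1 id}.
Proof.
by move=> a /asboolPn nex; rewrite /classical_inverse; case: pselect.
Qed.
End ClassicalUnits.

(** The local ring at P of the domain A, for a morphism pr from R to A and a
    prime P of R, realized inside the fraction field of A. *)
Section Localization.
Variables (R : comNzRingType) (A : idomainType) (pr : {rmorphism R -> A}).
Variable P : prime_idealr R.

Definition local_frac : {pred {fraction A}} :=
  fun u => `[< exists a s, s \notin (P : pred R) /\ u = (pr a)%:F / (pr s)%:F >].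

Lemma local_fracP u :
  reflect (exists a s, s \notin (P : pred R) /\ u = (pr a)%:F / (pr s)%:F)
          (u \in local_frac).
Proof. exact: asboolP. Qed.

Lemma notin_prime1 : 1 \notin (P : pred R).
Proof. by rewrite idealr1. Qed.

Lemma notin_primeM s t :
  s \notin (P : pred R) -> t \notin (P : pred R) -> s * t \notin (P : pred R).
Proof. by rewrite prime_idealrM negb_or => -> ->. Qed.

(** A fraction whose denominator vanishes in A is 0, by the convention on
    inverses; the two cases for the difference come from there. *)
Lemma local_frac_subring : subring_closed local_frac.
Proof.
have one_in : 1 \in local_frac.
  apply/local_fracP; exists 1, 1; split; first exact: notin_prime1.
  by rewrite !rmorph1 divr1.
split=> // u v /local_fracP[a [s [sP ->]]] /local_fracP[b [t [tP ->]]].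
  have [s0|s0] := eqVneq (pr s) 0.
    apply/local_fracP; exists (- b), t; split => //.
    by rewrite s0 rmorph0 invr0 mulr0 sub0r !rmorphN mulNr.
  have [t0|t0] := eqVneq (pr t) 0.
    apply/local_fracP; exists a, s; split => //.
    by rewrite t0 rmorph0 invr0 mulr0 subr0.
  apply/local_fracP; exists (a * t - b * s), (s * t); split.
    exact: notin_primeM.
  rewrite !(rmorphB, rmorphM) /=.
  by rewrite -[in LHS]mulNr addf_div ?tofrac_eq0 // mulNr.
apply/local_fracP; exists (a * b), (s * t); split; first exact: notin_primeM.
by rewrite !rmorphM invfM mulrACA.
Qed.

Record local_ring := LocalRing {
  local_val :> {fraction A}; local_valP : local_val \in local_frac }.

HB.instance Definition _ := [isSub for local_val].
HB.instance Definition _ := [Choice of local_ring by <:].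
HB.instance Definition _ :=
  GRing.SubChoice_isSubComNzRing.Build {fraction A} local_frac local_ring
    local_frac_subring.
HB.instance Definition _ := GRing.ComNzRing_hasMulInverse.Build local_ring
  (@mul_classical_inverse local_ring) (@has_inverseP local_ring)
  (@classical_inverse_out local_ring).

Lemma local_ring_idomain : GRing.integral_domain_axiom local_ring.
Proof.
move=> a b ab0; rewrite -!(inj_eq val_inj) -mulf_eq0 -rmorphM ab0.
by rewrite rmorph0.
Qed.

HB.instance Definition _ :=
  GRing.ComUnitRing_isIntegral.Build local_ring local_ring_idomain.

Lemma in_local_frac a : (pr a)%:F \in local_frac.
Proof.
apply/local_fracP; exists a, 1; split; first exact: notin_prime1.
by rewrite !rmorph1 divr1.
Qed.

Definition to_local (a : R) : local_ring := LocalRing (in_local_frac a).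

Lemma to_local_zmod_morphism : zmod_morphism to_local.
Proof. by move=> a b; apply: val_inj; rewrite /= !rmorphB. Qed.
Lemma to_local_monoid_morphism : monoid_morphism to_local.
Proof.
split; first by apply: val_inj; rewrite /= !rmorph1.
by move=> a b; apply: val_inj; rewrite /= !rmorphM.
Qed.
HB.instance Definition _ :=
  GRing.isZmodMorphism.Build R local_ring to_local to_local_zmod_morphism.
HB.instance Definition _ :=
  GRing.isMonoidMorphism.Build R local_ring to_local to_local_monoid_morphism.

Hypothesis kerP : forall a, pr a = 0 -> a \in (P : pred R).

Lemma notin_prime_neq0 s : s \notin (P : pred R) -> (pr s)%:F != 0.
Proof. by rewrite tofrac_eq0; apply: contraNneq => /kerP. Qed.

Lemma to_local_unit s : s \notin (P : pred R) -> to_local s \is a GRing.unit.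
Proof.
move=> sP; have inv_in : ((pr s)%:F)^-1 \in local_frac.
  by apply/local_fracP; exists 1, s; rewrite rmorph1 rmorph1 div1r.
apply/unitrP; exists (LocalRing inv_in).
by split; apply: val_inj; rewrite /= ?mulVf ?divff ?notin_prime_neq0.
Qed.

Lemma local_ring_repr (b : local_ring) :
  exists a s, s \notin (P : pred R) /\ b = to_local a / to_local s.
Proof.
have /local_fracP[a [s [sP def_b]]] := local_valP b; exists a, s; split => //.
apply: (canRL (mulrK (to_local_unit sP))); apply: val_inj.
by rewrite /= def_b divfK ?notin_prime_neq0.
Qed.

Lemma common_denominator n (u : nat -> local_ring) :
  exists s e, s \notin (P : pred R) /\
    forall i, (i < n)%N -> to_local s * u i = to_local (e i).
Proof.
elim: n => [|n [s [e [sP IHs]]]].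
  by exists 1, (fun=> 0); split => //; exact: notin_prime1.
have [a [t [tP def_u]]] := local_ring_repr (u n).
exists (s * t), (fun i => if i == n then s * a else t * e i).
split=> [|i]; first exact: notin_primeM.
rewrite rmorphM ltnS leq_eqVlt; case: eqVneq => [-> _ | _ /= /IHs def_e].
  by rewrite def_u -mulrA [to_local t * _]mulrC divrK ?to_local_unit ?rmorphM.
by rewrite mulrAC def_e mulrC rmorphM.
Qed.

Hypothesis pr_surj : forall a, exists b, pr b = a.
Hypothesis intA : integrally_closed A.

(** If w = b1/b2 is integral over the local ring and s is a common denominator
    of the coefficients of its equation, then s w is integral over A, hence in
    A. *)
Lemma local_ring_integrally_closed : integrally_closed local_ring.
Proof.
move=> u [q q_monic qu0]; have [b1 [b2 [b20 def_u]]] := fraction_repr u.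
pose n := (size q).-1; pose w := val b1 / val b2.
have vb20 : val b2 != 0.
  by rewrite -(rmorph0 (val : local_ring -> {fraction A})) (inj_eq val_inj).
have b2F0 : b2%:F != 0 by rewrite tofrac_eq0.
have szq : size q = n.+1 by rewrite prednK // size_poly_gt0 monic_neq0.
have val1 : val (1 : local_ring) = 1.
  exact: (rmorph1 (val : local_ring -> {fraction A})).
have qn1 : q`_n = 1 by apply/eqP; rewrite -monicE.
(* The equation of u, cleared of denominators, holds in the local ring, and
   can be read again in the fraction field of A. *)
have qw0 : \sum_(i < n.+1) val q`_i * w ^+ i = 0.
  have rel : \sum_(i < n.+1) q`_i * b1 ^+ i * b2 ^+ (n - i) = 0.
    apply/eqP; rewrite -tofrac_eq0 rmorph_sum /=; apply/eqP.
    transitivity (b2%:F ^+ n * (map_poly (@tofrac local_ring) q).[u]); last first.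
      by rewrite (rootP qu0) mulr0.
    rewrite (@horner_coef_wide _ n.+1) ?mulr_sumr ?(leq_trans (size_poly _ _)) ?szq //.
    apply: eq_bigr => i _; rewrite coef_map !rmorphM !rmorphXn /= def_u.
    by rewrite clear_denominator // -ltnS.
  apply: (mulfI (expf_neq0 n vb20)); rewrite mulr0.
  transitivity (val (\sum_(i < n.+1) q`_i * b1 ^+ i * b2 ^+ (n - i))).
    rewrite mulr_sumr rmorph_sum; apply: eq_bigr => i _.
    rewrite !rmorphM !rmorphXn.
    by rewrite /w clear_denominator // -ltnS.
  by rewrite rel rmorph0.
have [s [e [sP s_den]]] := common_denominator n (fun i => q`_i).
(* The monic equation of s w: its coefficient of X^i is s^(n-i) q_i. *)
pose q' : {poly A} := 'X^n + \poly_(i < n) pr (s ^+ (n - i.+1) * e i).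
have [|a def_a] := intA (u := (pr s)%:F * w).
  exists q'.
    rewrite monicE lead_coefDl ?lead_coefXn // size_polyXn ltnS.
    exact: size_poly.
  rewrite /root rmorphD /= map_polyXn hornerD hornerXn.
  rewrite (@horner_coef_wide _ n); last first.
    by rewrite (leq_trans (size_poly _ _)) ?size_poly.
  have := congr1 ( *%R ((pr s)%:F ^+ n)) qw0.
  rewrite mulr0 big_ord_recr /= qn1 val1 mul1r mulrDr -exprMn => qw0s.
  apply/eqP; rewrite -[RHS]qw0s addrC; congr (_ + _); rewrite mulr_sumr.
  apply: eq_bigr => i _; rewrite coef_map coef_poly ltn_ord /=.
  have := s_den i (ltn_ord i) => /(congr1 val) /= e_i.
  rewrite !rmorphM !rmorphXn /= -e_i.
  have -> : (pr s)%:F ^+ n = (pr s)%:F ^+ (n - i.+1) * (pr s)%:F * (pr s)%:F ^+ i.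
    by rewrite -exprSr -exprD -subSn // subSS subnK // ltnW.
  by rewrite exprMn -!mulrA; congr (_ * (_ * _)); rewrite mulrCA.
have [c def_c] := pr_surj a.
have w_in : w \in local_frac.
  apply/local_fracP; exists c, s; split => //.
  by rewrite def_c -def_a mulrAC divff ?mul1r ?notin_prime_neq0.
exists (LocalRing w_in); rewrite def_u; apply: (canLR (mulfK b2F0)).
rewrite -rmorphM; congr (_%:F); apply: val_inj => /=.
by rewrite divfK.
Qed.
End Localization.

Lemma normal_quotient_of_domain (R : comNzRingType) (I : set R) (A : idomainType)
    (pr : {rmorphism R -> A}) :
  (forall a, exists b, pr b = a) -> (forall a, I a <-> pr a = 0) ->
  integrally_closed A -> normal_quotient I.
Proof.
move=> pr_surj kerI intA P IP.
have kerP a : pr a = 0 -> a \in (P : pred R) by move=> /kerI /IP.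
exists (local_ring pr P), (to_local pr P).
split; last exact: local_ring_integrally_closed.
split; [exact: to_local_unit | exact: local_ring_repr | move=> a; split].
  move=> /(congr1 val) /= /eqP; rewrite tofrac_eq0 => /eqP pra0.
  by exists 1; [exact: notin_prime1 | apply/kerI; rewrite mul1r].
move=> [s sP /kerI]; rewrite rmorphM => /eqP; rewrite mulf_eq0 -tofrac_eq0.
rewrite (negbTE (notin_prime_neq0 kerP sP)) /= => /eqP pra0.
by apply: val_inj; rewrite /= pra0 rmorph0.
Qed.

(** * Quadratic extensions *)

(** d b^2 is a square only for b = 0: d is not a square in the fraction
    field. *)
Definition nonsquare (S : comNzRingType) (d : S) :=
  forall a b : S, a ^+ 2 = d * b ^+ 2 -> b = 0.

(** The ring S[sqrt d], of elements qre + qim sqrt d.  The type carries the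
    proof that d is not a square, so that its structure of integral domain can
    be inferred. *)
Record quad (S : comNzRingType) (d : S) (d_ns : nonsquare d) :=
  Quad { qre : S; qim : S }.

Section QuadRing.
Variables (S : idomainType) (d : S) (d_ns : nonsquare d).
Local Notation A := (quad d_ns).

Definition quad_pair (a : A) := (qre a, qim a).
Definition pair_quad (u : S * S) : A := Quad d_ns u.1 u.2.
Lemma quad_pairK : cancel quad_pair pair_quad. Proof. by case. Qed.

HB.instance Definition _ := Equality.copy A (can_type quad_pairK).
HB.instance Definition _ := Choice.copy A (can_type quad_pairK).

Lemma quadP (a b : A) : qre a = qre b -> qim a = qim b -> a = b.
Proof. by case: a b => [a1 a2] [b1 b2] /= -> ->. Qed.

Definition quad_add (a b : A) := Quad d_ns (qre a + qre b) (qim a + qim b).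
Definition quad_opp (a : A) := Quad d_ns (- qre a) (- qim a).
Definition quad_mul (a b : A) :=
  Quad d_ns (qre a * qre b + d * qim a * qim b) (qre a * qim b + qim a * qre b).

Lemma quad_addA : associative quad_add.
Proof. by move=> a b c; apply: quadP; apply: addrA. Qed.
Lemma quad_addC : commutative quad_add.
Proof. by move=> a b; apply: quadP; apply: addrC. Qed.
Lemma quad_add0 : left_id (Quad d_ns 0 0) quad_add.
Proof. by move=> a; apply: quadP; apply: add0r. Qed.
Lemma quad_addN : left_inverse (Quad d_ns 0 0) quad_opp quad_add.
Proof. by move=> a; apply: quadP; apply: addNr. Qed.
HB.instance Definition _ :=
  GRing.isZmodule.Build A quad_addA quad_addC quad_add0 quad_addN.

Lemma quad_mulA : associative quad_mul.
Proof. by move=> a b c; apply: quadP => /=; ring. Qed.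
Lemma quad_mulC : commutative quad_mul.
Proof. by move=> a b; apply: quadP => /=; ring. Qed.
Lemma quad_mul1 : left_id (Quad d_ns 1 0) quad_mul.
Proof. by move=> a; apply: quadP => /=; ring. Qed.
Lemma quad_mulD : left_distributive quad_mul quad_add.
Proof. by move=> a b c; apply: quadP => /=; ring. Qed.
Lemma quad_one_neq0 : Quad d_ns 1 0 != 0 :> A.
Proof. by apply/eqP => /(congr1 (@qre _ _ _)) /eqP; rewrite /= oner_eq0. Qed.
HB.instance Definition _ := GRing.Zmodule_isComNzRing.Build A
  quad_mulA quad_mulC quad_mul1 quad_mulD quad_one_neq0.
HB.instance Definition _ := GRing.ComNzRing_hasMulInverse.Build A
  (@mul_classical_inverse A) (@has_inverseP A) (@classical_inverse_out A).

Definition quadC (s : S) : A := Quad d_ns s 0.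
Definition quadY : A := Quad d_ns 0 1.
Definition quad_conj (a : A) : A := Quad d_ns (qre a) (- qim a).

Lemma qreM (a b : A) : qre (a * b) = qre a * qre b + d * qim a * qim b.
Proof. by []. Qed.
Lemma qimM (a b : A) : qim (a * b) = qre a * qim b + qim a * qre b.
Proof. by []. Qed.
Lemma qreD (a b : A) : qre (a + b) = qre a + qre b. Proof. by []. Qed.
Lemma qimD (a b : A) : qim (a + b) = qim a + qim b. Proof. by []. Qed.

Lemma quadC_zmod_morphism : zmod_morphism quadC.
Proof. by move=> s t; apply: quadP; rewrite //= subr0. Qed.
Lemma quadC_monoid_morphism : monoid_morphism quadC.
Proof. by split=> // s t; apply: quadP; rewrite /= ?qreM ?qimM /=; ring. Qed.
HB.instance Definition _ :=
  GRing.isZmodMorphism.Build S A quadC quadC_zmod_morphism.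
HB.instance Definition _ :=
  GRing.isMonoidMorphism.Build S A quadC quadC_monoid_morphism.

Lemma quad_conj_zmod_morphism : zmod_morphism quad_conj.
Proof. by move=> a b; apply: quadP; rewrite //= opprD. Qed.
Lemma quad_conj_monoid_morphism : monoid_morphism quad_conj.
Proof.
by split=> [|a b]; apply: quadP; rewrite //= ?oppr0 // ?qreM ?qimM /=; ring.
Qed.
HB.instance Definition _ :=
  GRing.isZmodMorphism.Build A A quad_conj quad_conj_zmod_morphism.
HB.instance Definition _ :=
  GRing.isMonoidMorphism.Build A A quad_conj quad_conj_monoid_morphism.

Lemma quad_repr (a : A) : a = quadC (qre a) + quadC (qim a) * quadY.
Proof. by apply: quadP; rewrite /= ?qreD ?qimD ?qreM ?qimM /=; ring. Qed.

Definition quad_norm (a : A) : S := qre a ^+ 2 - d * qim a ^+ 2.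

Lemma mul_quad_conj (a : A) : a * quad_conj a = quadC (quad_norm a).
Proof. by apply: quadP; rewrite /= ?qreM ?qimM /quad_norm /=; ring. Qed.

Lemma quadC_eq0 s : (quadC s == 0) = (s == 0).
Proof.
by apply/eqP/eqP => [/(congr1 (@qre _ _ _))|->]; last exact: rmorph0.
Qed.

Lemma quad_norm_eq0 a : (quad_norm a == 0) = (a == 0).
Proof.
apply/eqP/eqP => [/eqP|->]; last by rewrite /quad_norm /= !expr0n mulr0 subr0.
rewrite subr_eq0 => /eqP normE; have im0 := d_ns normE; apply: quadP => //.
by move: normE; rewrite im0 expr0n mulr0 => /eqP; rewrite expf_eq0 => /eqP.
Qed.

Lemma quad_integral : GRing.integral_domain_axiom A.
Proof.
move=> a b ab0; rewrite -!quad_norm_eq0 -mulf_eq0 -quadC_eq0 rmorphM /=.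
by rewrite -!mul_quad_conj mulrACA -rmorphM ab0 mul0r.
Qed.
HB.instance Definition _ := GRing.ComUnitRing_isIntegral.Build A quad_integral.

Lemma nonsquare_neq0 : d != 0.
Proof.
apply/eqP => d0; have : (0 : S) ^+ 2 = d * 1 ^+ 2 by rewrite d0 expr0n mul0r.
by move=> /d_ns /eqP; rewrite oner_eq0.
Qed.

Lemma rdvd_quadC s (a : A) : rdvd (quadC s) a <-> rdvd s (qre a) /\ rdvd s (qim a).
Proof.
split=> [[q ->]|[[s1 def1] [s2 def2]]].
  by split; [exists (qre q) | exists (qim q)]; rewrite ?qreM ?qimM /=; ring.
by exists (Quad d_ns s1 s2); apply: quadP; rewrite ?qreM ?qimM /= ?def1 ?def2; ring.
Qed.

(** Multiplying by the conjugate of the denominator, and using norms, reduces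
    to a denominator g and a multiplier w in S.  Let u be almost integral over
    g.  So is its conjugate, and then the sum 2 qre u, the product
    2 d qim u of the difference with sqrt d, and the square 4 d (qim u)^2 of
    the difference, over g^2, are almost integral elements of S.  Thus g divides
    qre u, d qim u = e g and d (qim u)^2 is a multiple f g^2; hence e^2 = f d,
    so d divides e and g divides qim u. *)
Lemma quad_cic (half : S) :
  completely_integrally_closed S -> half *+ 2 = 1 ->
  (forall e, rdvd d (e ^+ 2) -> rdvd d e) ->
  completely_integrally_closed A.
Proof.
move=> cicS half2 d_sqfree.
have cic_scalar (g w : S) (u : A) : g != 0 -> w != 0 ->
    almost_integral (quadC g) (quadC w) u -> rdvd (quadC g) u.
  move=> g0 w0 ai.
  have w20 : w ^+ 2 != 0 by rewrite expf_neq0.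
  have scalar_dvd h (v : A) : almost_integral (quadC h) (quadC w ^+ 2) v ->
      qim v = 0 -> rdvd h (qre v).
    move=> aiv v_im; apply: (cicS _ _ (w ^+ 2)) => // n.
    have def_v : v = quadC (qre v) by apply: quadP.
    have := aiv n; rewrite {1}def_v -!rmorphXn -rmorphM /=.
    by case/rdvd_quadC.
  have aic : almost_integral (quadC g) (quadC w) (quad_conj u).
    move=> n; have [e /(congr1 quad_conj)] := ai n.
    rewrite !(rmorphM, rmorphXn) /= => conj_e; exists (quad_conj e).
    move: conj_e; rewrite (_ : quad_conj (quadC g) = quadC g); last first.
      by apply: quadP; rewrite //= oppr0.
    rewrite (_ : quad_conj (quadC w) = quadC w) //.
    by apply: quadP; rewrite //= oppr0.
  have halve (h s : S) : rdvd h (s *+ 2) -> rdvd h s.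
    move=> [e def_s]; exists (half * e).
    by rewrite -mulrA -def_s mulrnAr -mulrnAl half2 mul1r.
  apply/rdvd_quadC; split.
    have := scalar_dvd _ _ (almost_integralD ai aic); rewrite qreD qimD /= subrr.
    by move=> /(_ erefl) /halve.
  pose v := u + -1 * quad_conj u.
  have aiv : almost_integral (quadC g) (quadC w ^+ 2) v.
    exact: almost_integralD ai (almost_integralMl _ aic).
  have def_v : v = Quad d_ns 0 (qim u *+ 2).
    by apply: quadP; rewrite /v mulN1r /= ?subrr // opprK mulr2n.
  have [e def_e] : rdvd g (d * qim u).
    have def_Yv : quadY * v = quadC (d * qim u *+ 2).
      by rewrite def_v; apply: quadP; rewrite ?qreM ?qimM /=; ring.
    apply: halve; have := scalar_dvd _ _ (almost_integralMl quadY aiv).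
    by rewrite def_Yv => /(_ erefl).
  have [f def_f] : rdvd (g ^+ 2) (d * qim u ^+ 2).
    have def_v2 : v ^+ 2 = quadC (d * qim u ^+ 2 *+ 4).
      by rewrite def_v expr2; apply: quadP; rewrite ?qreM ?qimM /=; ring.
    apply: (halve _ _ (halve _ _ _)); rewrite -mulrnA.
    have : almost_integral (quadC (g ^+ 2)) (quadC w ^+ 2) (v ^+ 2).
      by move=> n; rewrite rmorphXn -!exprM.
    by move=> /scalar_dvd; rewrite def_v2 => /(_ erefl).
  have [e' def_e'] : rdvd d e.
    apply: d_sqfree; exists f.
    apply: (mulIf (expf_neq0 2 g0)).
    by rewrite -exprMn -def_e mulrAC -def_f; ring.
  exists e'; apply: (mulfI nonsquare_neq0).
  by rewrite def_e def_e'; ring.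
move=> a b w w0.
have [->|b0 ai] := eqVneq b 0; first exact: almost_integral0.
have bb0 : quad_conj b != 0.
  apply: contraNneq b0 => bb0; rewrite -quad_norm_eq0 -quadC_eq0.
  by rewrite -mul_quad_conj bb0 mulr0.
apply: (rdvd_mul2r bb0); rewrite mul_quad_conj.
apply: (cic_scalar _ (quad_norm w)); rewrite ?quad_norm_eq0 //.
move=> n; have [e def_e] := ai n.
exists (quad_conj w * e); rewrite -!mul_quad_conj !exprMn.
by rewrite mulrACA def_e mulrACA [_ * e]mulrC.
Qed.
End QuadRing.

(** * The coordinate ring of a fibre of p *)

Section Quadric.
Variables (k : fieldType) (c : k).
Local Notation S := {poly {poly k}}.

(** In k[x][z] the inner variable is x, the outer one is z. *)
Definition bivX : S := 'X%:P.
Definition bivC (a : k) : S := a%:P%:P.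
HB.instance Definition _ := GRing.RMorphism.copy bivC (polyC \o polyC).

(** xz - c, the square of y on the fibre p = c. *)
Definition disc : S := bivX * 'X - bivC c.

Lemma size_disc : size disc = 2.
Proof.
by rewrite /disc -[- _]polyCN size_MXaddC polyC_eq0 polyX_eq0 size_polyC polyX_eq0.
Qed.

(** Parity of the degree in z, in which xz - c has degree 1. *)
Lemma disc_nonsquare : nonsquare disc.
Proof.
move=> a b eq_ab; apply/eqP; apply: contraT => b0.
have d0 : disc != 0 by rewrite -size_poly_gt0 size_disc.
have a0 : a != 0.
  by rewrite -sqrf_eq0 eq_ab mulf_neq0 ?expf_neq0.
have := congr1 (fun q : S => odd (size q)) eq_ab.
rewrite !expr2 !size_mul ?mulf_neq0 // size_disc.
rewrite (polySpred a0) (polySpred b0) !addSn !addnS /= !addnn.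
by rewrite !odd_double.
Qed.

Lemma disc_neq0 : disc != 0.
Proof. by rewrite -size_poly_gt0 size_disc. Qed.

Lemma lead_coef_disc : lead_coef disc = 'X.
Proof.
by rewrite lead_coefE size_disc /disc coefB coefMX /= !coefC /= subr0.
Qed.

(** From x e = q (xz - c) follows c q = x (q z - e), so that x divides q. *)
Lemma rdvd_bivX_cancel (e : S) n : c != 0 -> rdvd disc (bivX ^+ n * e) -> rdvd disc e.
Proof.
move=> c0; have cK : bivC c * bivC c^-1 = 1 by rewrite -rmorphM divff // rmorph1.
have x0 : bivX != 0 by rewrite polyC_eq0 polyX_eq0.
elim: n => [|n IHn]; first by rewrite mul1r.
move=> [q]; rewrite exprS -mulrA => def_e; apply: IHn.
exists (bivC c^-1 * (q * 'X - bivX ^+ n * e)); apply: (mulfI x0).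
have def_q : bivC c * q = bivX * (q * 'X - bivX ^+ n * e).
  by rewrite mulrBr def_e /disc; ring.
set u := _ - _ in def_q *; rewrite -[in RHS]mulrA [RHS]mulrCA.
rewrite [bivX * (u * _)]mulrA -def_q -[_ * q * _]mulrA -def_e [RHS]mulrA.
by rewrite [_ * bivC c]mulrC cK mul1r.
Qed.

Lemma rdvd_polyX_sqr (e : S) : rdvd 'X (e ^+ 2) -> rdvd 'X e.
Proof.
move=> [q def_q]; have /factor_theorem[h] : root e 0.
  by rewrite /root -sqrf_eq0 -horner_exp def_q hornerM hornerX mulr0.
by rewrite subr0; exists h.
Qed.

Lemma rdvd_bivX_sqr (e : S) : rdvd bivX (e ^+ 2) -> rdvd bivX e.
Proof.
move=> [q def_q]; pose red := map_poly (horner_eval (0 : k)).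
have red_e : red e = 0.
  apply/eqP; rewrite -sqrf_eq0 -rmorphXn /= def_q rmorphM /= /red map_polyC.
  by rewrite /= /horner_eval hornerX mulr0.
exists (\poly_(i < size e) (e`_i %/ 'X)).
apply/polyP => i; rewrite mulrC coefCM coef_poly; case: ltnP => [_|le_ei]; last first.
  by rewrite mulr0 nth_default.
rewrite mulrC divpK //.
have := congr1 (fun q : {poly k} => q`_i) red_e.
rewrite coef0 coef_map /= /horner_eval => /eqP.
by rewrite -/(root _ _) -dvdp_XsubCl subr0.
Qed.

(** For c = 0, x and z divide e one after the other.  For c <> 0, pseudo-division
    by xz - c in z gives x^m e = q (xz - c) + t with t in k[x]; then xz - c
    divides t^2, which has degree 0 in z, so t = 0. *)
Lemma disc_sqfree (e : S) : rdvd disc (e ^+ 2) -> rdvd disc e.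
Proof.
have [c0|c0] := eqVneq c 0.
  have -> : disc = bivX * 'X by rewrite /disc c0 rmorph0 subr0.
  move=> [q def_q].
  have [e1 def_e] : rdvd 'X e.
    by apply: rdvd_polyX_sqr; exists (q * bivX); rewrite def_q mulrA.
  have [q1 def_q1] : rdvd 'X q.
    have : q`_0 = 0.
      have := congr1 (fun g : S => g`_1) def_q.
      rewrite def_e exprMn coefMXn mulrA coefMX coefMC /=.
      by move/esym/eqP; rewrite mulf_eq0 polyX_eq0 orbF => /eqP.
    rewrite -horner_coef0 => /rootP /factor_theorem[q1 ->].
    by rewrite subr0; exists q1.
  have [e2 def_e1] : rdvd bivX e1.
    apply: rdvd_bivX_sqr; exists q1.
    apply: (@mulIf _ ('X ^+ 2)); first by rewrite expf_neq0 ?polyX_eq0.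
    by rewrite -exprMn -def_e def_q def_q1; ring.
  by exists e2; rewrite def_e def_e1 mulrA.
move=> [f def_f].
have := Pdiv.WeakIdomain.divp_eq e disc.
set m := scalp _ _; set q := (_ %/ _); set t := (_ %% _).
rewrite lead_coef_disc -mul_polyC rmorphXn /= -/bivX => def_e.
suff t0 : t = 0.
  by apply: (@rdvd_bivX_cancel _ m) => //; exists q; rewrite def_e t0 addr0.
have [h t_dvd] : rdvd disc (t ^+ 2).
  exists (bivX ^+ m ^+ 2 * f - (bivX ^+ m * e + t) * q).
  have def_qd : q * disc = bivX ^+ m * e - t by rewrite def_e addrK.
  rewrite mulrBl -mulrA -def_f -exprMn -[_ * q * _]mulrA def_qd.
  by rewrite [(_ + t) * _]mulrC -subr_sqr opprB addrC subrK.
apply/eqP; apply: contraT => t0.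
have : (size (t ^+ 2) <= 1)%N.
  have : (size t < size disc)%N by rewrite ltn_modp disc_neq0.
  rewrite size_disc ltnS.
  by move=> /size1_polyC ->; rewrite -rmorphXn size_polyC_leq1.
have : t ^+ 2 != 0 by rewrite expf_neq0.
rewrite t_dvd mulf_eq0 negb_or => /andP[h0 _].
rewrite size_mul ?disc_neq0 // size_disc addnS /= addn1 ltnS leqn0.
by rewrite size_poly_eq0 (negbTE h0).
Qed.
End Quadric.

Lemma mpoly_ring_ind (n : nat) (R : comNzRingType) (Q : {mpoly R[n]} -> Prop) :
  (forall a, Q a%:MP) -> (forall i, Q 'X_i) ->
  (forall f g, Q f -> Q g -> Q (f + g)) -> (forall f g, Q f -> Q g -> Q (f * g)) ->
  forall f, Q f.
Proof.
move=> QC QX QD QM; apply: mpolyind => [|a m f _ _ Qf].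
  by rewrite -mpolyC0; apply: QC.
apply: QD => //; rewrite -mul_mpolyC; apply: (QM) => //; rewrite mpolyXE_id.
elim/big_rec: _ => [|i g _ Qg]; first by rewrite -mpolyC1; apply: QC.
apply: (QM) => //; elim: (m i) => [|e IHe]; first by rewrite expr0 -mpolyC1; apply: QC.
by rewrite exprS; apply: (QM).
Qed.

Section Bivariate.
Variables (k : fieldType) (T : comNzRingType) (f : {rmorphism k -> T}) (a b : T).

(** The substitution x := a, z := b. *)
Definition biv_eval : {poly {poly k}} -> T :=
  horner_eval b \o map_poly (horner_eval a \o map_poly f).
HB.instance Definition _ := GRing.RMorphism.on biv_eval.

Lemma biv_evalX : biv_eval (bivX k) = a.
Proof.
rewrite /biv_eval /bivX /= map_polyC /horner_eval hornerC /= map_polyX.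
by rewrite /horner_eval hornerX.
Qed.
Lemma biv_evalZ : biv_eval 'X = b.
Proof. by rewrite /biv_eval /= map_polyX /horner_eval hornerX. Qed.
Lemma biv_evalC c : biv_eval (bivC c) = f c.
Proof.
rewrite /biv_eval /bivC /= map_polyC /horner_eval hornerC /= map_polyC.
by rewrite /horner_eval hornerC.
Qed.
Lemma biv_eval_disc c : biv_eval (disc c) = a * b - f c.
Proof.
by rewrite /disc rmorphB rmorphM /= biv_evalX biv_evalZ biv_evalC.
Qed.
End Bivariate.

Lemma rmorph_biv_eval (k : fieldType) (T U : comNzRingType) (f : {rmorphism k -> T})
    (g : {rmorphism k -> U}) (h : {rmorphism T -> U}) a b s :
  h \o f =1 g -> h (biv_eval f a b s) = biv_eval g (h a) (h b) s.
Proof.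
move=> hf; rewrite /biv_eval /= /horner_eval -horner_map -map_poly_comp.
congr (_.[_]); apply: eq_map_poly => u /=; rewrite -horner_map -map_poly_comp.
by congr (_.[_]); apply: eq_map_poly.
Qed.

Lemma biv_eval_id (k : fieldType) (s : {poly {poly k}}) :
  biv_eval (T := {poly {poly k}}) (@bivC k) (bivX k) 'X s = s.
Proof.
rewrite /biv_eval /= /horner_eval -[RHS](comp_polyXr s).
congr (_.[_]); apply: eq_map_poly => u /=; rewrite /horner_eval.
have -> : map_poly (@bivC k) u = map_poly polyC (map_poly polyC u).
  by rewrite -map_poly_comp.
by rewrite horner_map; congr polyC; apply: comp_polyXr.
Qed.

Section ClosedField.
Variable k : closedFieldType.

Lemma poly_vanish (u : {poly k}) : (forall a, u.[a] = 0) -> u = 0.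
Proof.
move=> u0; apply/eqP; apply: contraT => /closed_nonrootP[a].
by rewrite /root u0 eqxx.
Qed.

Lemma biv_vanish (s : {poly {poly k}}) :
  (forall a b, biv_eval idfun a b s = 0) -> s = 0.
Proof.
move=> s0; apply/polyP => i; rewrite coef0; apply: poly_vanish => a.
have : map_poly (horner_eval a \o map_poly idfun) s = 0.
  by apply: poly_vanish => b; apply: s0.
move=> /(congr1 (fun q : {poly k} => q`_i)).
by rewrite coef0 coef_map /= map_poly_id.
Qed.

Lemma exists_sqrt (a : k) : exists b, b ^+ 2 = a.
Proof.
have /closed_rootP[b] : size ('X^2 - a%:P) != 1 by rewrite size_XnsubC.
by rewrite /root hornerD hornerN hornerXn hornerC subr_eq0 => /eqP; exists b.
Qed.
End ClosedField.

Section QuadricRing.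
Variables (k : fieldType) (c : k).
Local Notation R := {mpoly k[3]}.
Local Notation S := {poly {poly k}}.

Local Notation A := (quad (@disc_nonsquare k c)).

(* The default value of nth is the image of the last variable z. *)
Definition quadric_coord (i : 'I_3) : A :=
  nth (quadC _ 'X) [:: quadC _ (bivX k); quadY _] i.

Definition quadric_map : R -> A :=
  mmap (quadC _ \o @bivC k : {rmorphism k -> A}) quadric_coord.
HB.instance Definition _ := GRing.RMorphism.on quadric_map.

Definition quadric_lift (s : S) : R := biv_eval (@mpolyC 3 k) (x k) (z k) s.
HB.instance Definition _ := GRing.RMorphism.copy quadric_lift
  (biv_eval (T := R) (@mpolyC 3 k) (x k) (z k)).

(** The section of [quadric_map] that writes a class modulo p - c as
    a(x,z) + b(x,z) y. *)
Definition quadric_normal_form (a : A) : R :=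
  quadric_lift (qre a) + quadric_lift (qim a) * y k.

Lemma quadric_normal_formD a b :
  quadric_normal_form (a + b) = quadric_normal_form a + quadric_normal_form b.
Proof. by rewrite /quadric_normal_form qreD qimD !rmorphD /= mulrDl addrACA. Qed.

Lemma quadric_lift_disc : quadric_lift (disc c) = x k * z k - c%:MP.
Proof. exact: biv_eval_disc. Qed.

Lemma quadric_map_x : quadric_map (x k) = quadC _ (bivX k).
Proof. by rewrite /quadric_map /x mmapX mmap1U. Qed.
Lemma quadric_map_y : quadric_map (y k) = quadY _.
Proof. by rewrite /quadric_map /y mmapX mmap1U. Qed.
Lemma quadric_map_z : quadric_map (z k) = quadC _ 'X.
Proof. by rewrite /quadric_map /z mmapX mmap1U. Qed.

Lemma quadric_map_lift s : quadric_map (quadric_lift s) = quadC _ s.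
Proof.
pose g : {rmorphism k -> A} := quadC _ \o @bivC k.
rewrite (@rmorph_biv_eval _ _ _ _ g quadric_map) => [|a]; last exact: mmapC.
rewrite /= quadric_map_x quadric_map_z.
have := @rmorph_biv_eval k S A (@bivC k) g (@quadC S _ _) (bivX k) 'X s.
by move=> <-; first by rewrite biv_eval_id.
Qed.

Lemma quadric_mapK a : quadric_map (quadric_normal_form a) = a.
Proof.
rewrite /quadric_normal_form rmorphD rmorphM /= !quadric_map_lift quadric_map_y.
by rewrite -quad_repr.
Qed.

Lemma quadric_map_eq0 : quadric_map (p k - c%:MP) = 0.
Proof.
have -> : p k - c%:MP = quadric_lift (disc c) - y k ^+ 2.
  by rewrite quadric_lift_disc /p addrAC.
rewrite rmorphB rmorphXn /= quadric_map_lift quadric_map_y.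
by apply: quadP => /=; ring.
Qed.

(** y^2 and xz - c differ by p - c. *)
Lemma quadric_normal_formM a b : rdvd (p k - c%:MP)
  (quadric_normal_form a * quadric_normal_form b - quadric_normal_form (a * b)).
Proof.
exists (- (quadric_lift (qim a) * quadric_lift (qim b))).
have -> : p k - c%:MP = quadric_lift (disc c) - y k ^+ 2.
  by rewrite quadric_lift_disc /p addrAC.
rewrite /quadric_normal_form qreM qimM !(rmorphD, rmorphM) /=.
move: (quadric_lift _) (quadric_lift _) (quadric_lift _) (quadric_lift _).
by move: (quadric_lift _) => d a1 a2 b1 b2; ring.
Qed.

Lemma quadric_normal_formP f :
  rdvd (p k - c%:MP) (f - quadric_normal_form (quadric_map f)).
Proof.
elim/mpoly_ring_ind: f => [a|i|f g [u def_f] [v def_g]|f g [u def_f] [v def_g]].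
- exists 0; rewrite mul0r /quadric_map mmapC /quadric_normal_form /=.
  by rewrite rmorph0 mul0r addr0 /quadric_lift (biv_evalC (@mpolyC 3 k)) subrr.
- exists 0; rewrite mul0r; apply/eqP; rewrite subr_eq0; apply/eqP.
  rewrite /quadric_map mmapX mmap1U /quadric_normal_form /quadric_coord.
  case: i => [[|[|[|//]]] lti] /=; rewrite ?rmorph0 ?rmorph1 ?(mul0r, addr0, mul1r, add0r).
  + by rewrite /quadric_lift biv_evalX /x; congr 'X__; apply: val_inj.
  + by rewrite /y; congr 'X__; apply: val_inj.
  + by rewrite /quadric_lift biv_evalZ /z; congr 'X__; apply: val_inj.
- exists (u + v); rewrite mulrDl -def_f -def_g rmorphD quadric_normal_formD.
  by rewrite opprD addrACA.
set a := quadric_map f in def_f; set b := quadric_map g in def_g.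
rewrite rmorphM /= -/a -/b; have [w def_w] := quadric_normal_formM a b.
exists (u * g + quadric_normal_form a * v + w).
rewrite (mulrDl (_ + _) w) (mulrDl (u * g)) mulrAC -def_f -[_ * v * _]mulrA.
by rewrite -def_g -def_w mulrBl mulrBr !subrKA.
Qed.
End QuadricRing.

Lemma char0_natr_neq0 (k : fieldType) n : [pchar k] =i pred0 -> n.+1%:R != 0 :> k.
Proof. by move=> /pcharf0P ->. Qed.

Lemma eval_p (k : fieldType) (v : 'I_3 -> k) :
  (p k).@[v] = v 0 * v 2 - v 1 ^+ 2.
Proof. by rewrite /p /x /y /z mevalB mevalM rmorphXn /= !mevalXU. Qed.

(** A normal form a + b y that vanishes on the surface vanishes at both points
    (u, e, w) and (u, -e, w) with e^2 = uw - c; so a(u, w) = 0, and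
    b(u, w) e = 0.  Hence a = 0 and (xz - c) b = 0. *)
Lemma quadric_nullstellensatz (k : closedFieldType) (c : k) (f : {mpoly k[3]}) :
  [pchar k] =i pred0 ->
  (forall v : 'rV[k]_3, (p k).@[v 0] = c -> f.@[v 0] = 0) ->
  fiber_ideal (p k) c f.
Proof.
move=> char0 f0; have [h def_f] := quadric_normal_formP c f.
set a := quadric_map c f in def_f.
have eval_lift (v : 'rV[k]_3) (s : {poly {poly k}}) :
    (quadric_lift s).@[v 0] = biv_eval idfun (v 0 0) (v 0 2) s.
  rewrite /quadric_lift (@rmorph_biv_eval _ _ _ _ idfun (meval (v 0))).
    by rewrite /x /z /= !mevalXU.
  by move=> u /=; rewrite mevalC.
have eval_a (u w e : k) : e ^+ 2 = u * w - c ->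
    biv_eval idfun u w (qre a) + biv_eval idfun u w (qim a) * e = 0.
  move=> def_e; pose v : 'rV[k]_3 := \row_i nth w [:: u; e] i.
  have pv : (p k).@[v 0] = c.
    by rewrite eval_p !mxE /= def_e subKr.
  have := congr1 (meval (v 0)) def_f.
  rewrite mevalM (mevalB _ f) (mevalB _ (p k)) mevalC pv subrr mulr0 f0 // sub0r.
  rewrite /quadric_normal_form mevalD mevalM !eval_lift /y mevalXU !mxE /=.
  by move=> /eqP; rewrite oppr_eq0 => /eqP.
have two0 : 2 != 0 :> k := char0_natr_neq0 1 char0.
have re0 : qre a = 0.
  apply: biv_vanish => u w; have [e def_e] := exists_sqrt (u * w - c).
  have := eval_a u w _ def_e; have := eval_a u w (- e); rewrite sqrrN => /(_ def_e).
  move=> em ep; apply: (mulfI two0); rewrite mulr0 -[RHS]addr0 -{1}em -ep; ring.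
have im0 : qim a = 0.
  apply: (mulfI (disc_neq0 c)); rewrite mulr0; apply: biv_vanish => u w.
  have [e def_e] := exists_sqrt (u * w - c).
  have := eval_a u w _ def_e; rewrite re0 rmorph0 add0r => ime0.
  have disc_e : biv_eval idfun u w (disc c) = e ^+ 2.
    by rewrite biv_eval_disc def_e.
  rewrite (rmorphM (biv_eval idfun u w)) /= disc_e expr2.
  by rewrite -mulrA (mulrC e (biv_eval _ _ _ _)) ime0 mulr0.
exists h; rewrite -def_f /quadric_normal_form re0 im0 !rmorph0.
by rewrite mul0r addr0 subr0.
Qed.

Lemma quadric_normal (k : closedFieldType) (c : k) :
  [pchar k] =i pred0 -> fiber_normal (p k) c.
Proof.
move=> char0; apply: (@normal_quotient_of_domain {mpoly k[3]}
  (fiber_ideal (p k) c) (quad (@disc_nonsquare k c)) (quadric_map c)).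
- by move=> a; exists (quadric_normal_form a); apply: quadric_mapK.
- move=> a; split=> [[h ->]|a0]; first by rewrite rmorphM /= quadric_map_eq0 mulr0.
  have := quadric_normal_formP c a; rewrite a0.
  by rewrite /quadric_normal_form /= rmorph0 mul0r addr0 subr0.
apply: cic_integrally_closed; apply: (@quad_cic _ _ _ (bivC 2^-1)).
- exact/poly_cic/poly_cic/field_cic.
- by rewrite -rmorphMn /= -mulr_natl divff ?rmorph1 // char0_natr_neq0.
- exact: disc_sqfree.
Qed.

(** * Descent of open sets and regular functions *)

Section Zariski.
Variables (k : fieldType) (n : nat) (T : Type) (iota : T -> 'rV[k]_n).

(** Openness tested with basic open sets at each point, a local criterion. *)
Lemma zariski_openP (U : set T) :
  zariski_open iota U <-> forall t, U t -> exists2 g : {mpoly k[n]},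
    g.@[iota t 0] != 0 & forall s, g.@[iota s 0] != 0 -> U s.
Proof.
split=> [[E ->] t [g Eg gt0]|U_open]; first by exists g => // s gs0; exists g.
exists [set g | forall s, g.@[iota s 0] != 0 -> U s].
apply/seteqP; split=> [t /U_open[g gt0 gU]|t [g gU gt0]]; last exact: gU.
by exists g.
Qed.

Lemma zariski_regularP (U : set T) (f : T -> k) :
  zariski_regular iota U f <-> forall t, U t -> exists a b : {mpoly k[n]},
    b.@[iota t 0] != 0 /\
    forall s, b.@[iota s 0] != 0 -> U s /\ f s = a.@[iota s 0] / b.@[iota s 0].
Proof.
split=> f_reg t Ut.
  have [W [a [b [/zariski_openP W_open Wt WU fE]]]] := f_reg t Ut.
  have [g gt0 gW] := W_open t Wt; exists (a * g), (b * g); split.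
    by rewrite mevalM mulf_neq0 // (fE t Wt).1.
  move=> s; rewrite !mevalM mulf_eq0 negb_or => /andP[bs0 gs0].
  by split; [exact/WU/gW | rewrite (fE s (gW s gs0)).2 -mulf_div divff ?mulr1].
have [a [b [bt0 fE]]] := f_reg t Ut.
exists [set s | b.@[iota s 0] != 0], a, b; split => //.
- by apply/zariski_openP => s bs0; exists b.
- by move=> s /fE[].
- by move=> s bs0; split => //; exact: (fE s bs0).2.
Qed.
End Zariski.

Section RationalMaps.
Variables (k : fieldType) (m n : nat) (S T : Type).
Variables (iota : S -> 'rV[k]_m) (kappa : T -> 'rV[k]_n).

(** On the basic open set b <> 0 the map u is given by fractions with
    denominator b. *)
Definition rational_on (b : {mpoly k[m]}) (u : S -> T) : Prop :=
  exists a : 'I_n -> {mpoly k[m]}, forall s, b.@[iota s 0] != 0 ->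
    forall j, kappa (u s) 0 j = (a j).@[iota s 0] / b.@[iota s 0].

Variables (b : {mpoly k[m]}) (u : S -> T).
Hypothesis u_rat : rational_on b u.

Lemma rational_poly (g : {mpoly k[n]}) : exists N (g' : {mpoly k[m]}), forall s,
  b.@[iota s 0] != 0 -> g.@[kappa (u s) 0] = g'.@[iota s 0] / b.@[iota s 0] ^+ N.
Proof.
have [a aE] := u_rat.
elim/mpoly_ring_ind: g => [c|i|f g [N [f' fE]] [M [g' gE]]|f g [N [f' fE]] [M [g' gE]]].
- by exists 0, c%:MP => s _; rewrite !mevalC expr0 divr1.
- by exists 1%N, (a i) => s bs0; rewrite mevalXU aE.
- exists (N + M)%N, (f' * b ^+ M + g' * b ^+ N) => s bs0.
  rewrite mevalD fE // gE // addf_div ?expf_neq0 // mevalD !mevalM !rmorphXn.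
  by rewrite exprD.
- exists (N + M)%N, (f' * g') => s bs0.
  by rewrite !mevalM fE // gE // mulf_div exprD.
Qed.

Lemma rational_open (U : set T) : zariski_open kappa U ->
  zariski_open iota [set s | b.@[iota s 0] != 0 /\ U (u s)].
Proof.
move=> /zariski_openP U_open; apply/zariski_openP => s [bs0 Us].
have [g gs0 gU] := U_open _ Us; have [N [g' gE]] := rational_poly g.
exists (g' * b).
  by rewrite mevalM mulf_neq0 //; move: gs0; rewrite gE // mulf_eq0 negb_or => /andP[].
move=> t; rewrite mevalM mulf_eq0 negb_or => /andP[gt0 bt0]; split => //.
by apply: gU; rewrite gE // mulf_neq0 // invr_eq0 expf_neq0.
Qed.

Lemma rational_regular (U : set T) (f : T -> k) : zariski_regular kappa U f ->
  zariski_regular iota [set s | b.@[iota s 0] != 0 /\ U (u s)] (f \o u).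
Proof.
move=> /zariski_regularP f_reg; apply/zariski_regularP => s [bs0 Us].
have [c [d [ds0 fE]]] := f_reg _ Us.
have [N [c' cE]] := rational_poly c; have [M [d' dE]] := rational_poly d.
exists (c' * b ^+ M * b), (d' * b ^+ N * b).
have nz t : b.@[iota t 0] != 0 ->
    ((d' * b ^+ N * b).@[iota t 0] != 0) = (d.@[kappa (u t) 0] != 0).
  move=> bt0; rewrite !mevalM rmorphXn dE // !mulf_eq0 invr_eq0 !expf_eq0 /=.
  by rewrite (negbTE bt0) !andbF !orbF.
split=> [|t]; first by rewrite nz.
have [bt0|bt0] := eqVneq b.@[iota t 0] 0.
  by rewrite mevalM bt0 mulr0 eqxx.
rewrite nz // => dt0; split; first by split => //; exact: (fE _ dt0).1.
rewrite /= (fE _ dt0).2 cE // dE // !mevalM !rmorphXn /=.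
rewrite -[RHS]mulf_div divff // mulr1 invf_div mulf_div.
by rewrite [X in _ = _ / X]mulrC.
Qed.
End RationalMaps.

Section Descent.
Variables (k : fieldType) (m n : nat) (S T : Type).
Variables (iota : S -> 'rV[k]_m) (kappa : T -> 'rV[k]_n) (q : S -> T).

(** A polynomial map with rational sections over the members of an open cover
    of its target. *)
Definition locally_split : Prop :=
  rational_on iota kappa 1 q /\
  forall t, exists (b : {mpoly k[n]}) (u : T -> S),
    [/\ b.@[kappa t 0] != 0, rational_on kappa iota b u &
        forall t', b.@[kappa t' 0] != 0 -> q (u t') = t'].

Hypothesis q_split : locally_split.

Let set1E (U : set S) : [set s | (1 : {mpoly k[m]}).@[iota s 0] != 0 /\ U s] = U.
Proof.
by apply/seteqP; split=> s; rewrite /= meval1 oner_eq0; [case | split].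
Qed.

(** The trace of U on the domain b <> 0 of a section u is the preimage by u of
    the preimage of U by q. *)
Lemma split_open (U : set T) :
  zariski_open kappa U <-> zariski_open iota (q @^-1` U).
Proof.
have [q_rat q_sec] := q_split; split=> U_open.
  by have := rational_open q_rat U_open; rewrite (set1E (q @^-1` U)).
apply/zariski_openP => t Ut; have [b [u [bt0 u_rat uK]]] := q_sec t.
have /zariski_openP/(_ t) := rational_open u_rat U_open.
case; first by split; rewrite //= uK.
by move=> g gt0 gU; exists g => // s /gU[bs0]; rewrite /= uK.
Qed.

Lemma split_regular (U : set T) (f : T -> k) :
  zariski_regular kappa U f <-> zariski_regular iota (q @^-1` U) (f \o q).
Proof.
have [q_rat q_sec] := q_split; split=> f_reg.
  by have := rational_regular q_rat f_reg; rewrite (set1E (q @^-1` U)).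
apply/zariski_regularP => t Ut; have [b [u [bt0 u_rat uK]]] := q_sec t.
have /zariski_regularP/(_ t) := rational_regular u_rat f_reg.
case; first by split; rewrite //= uK.
move=> c [d [dt0 fE]]; exists c, d; split => // s /fE[[bs0]].
by rewrite /= uK.
Qed.
End Descent.

Lemma isomorphic_trans (k : fieldType) (X Y Z : funspace k) :
  isomorphic X Y -> isomorphic Y Z -> isomorphic X Z.
Proof.
move=> [f [f_bij f_open f_reg]] [g [g_bij g_open g_reg]].
exists (g \o f); split; first exact: bij_comp.
  by move=> U; rewrite g_open f_open.
move=> U h U_open; rewrite g_reg // f_reg //; exact/g_open.
Qed.

Lemma split_isomorphic (k : fieldType) (m n : nat) (S T : Type)
    (iota : S -> 'rV[k]_m) (kappa : T -> 'rV[k]_n) (q : S -> T) :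
  bijective q -> locally_split iota kappa q ->
  isomorphic (embedded_space iota) (embedded_space kappa).
Proof.
move=> q_bij q_split; exists q; split => //; first exact: split_open.
by move=> U f _; exact: split_regular.
Qed.

(** A locally split map out of SL_2 whose fibres are the cosets of T presents
    its target as the quotient variety, since both sides carry the quotient
    topology and the functions whose pullback is regular. *)
Lemma split_isomorphic_SL2modT (k : fieldType) (n : nat) (T : Type)
    (kappa : T -> 'rV[k]_n) (q : SL2 k -> T) :
  locally_split (fun g : SL2 k => mxvec (val g)) kappa q ->
  (forall g h, torus_coset g h <-> q h = q g) ->
  isomorphic (embedded_space kappa) (SL2modT_space k).
Proof.
move=> q_split cosetE; have [_ q_sec] := q_split.
have q_surj t : exists g, q g = t.
  by have [b [u [bt0 _ uK]]] := q_sec t; exists (u t); exact: uK.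
pose rep t := sval (cid (q_surj t)).
have repK t : q (rep t) = t by rewrite /rep; case: cid.
pose phi t := SL2modT_pi (rep t).
have pi_eq g h : SL2modT_pi g = SL2modT_pi h <-> q g = q h.
  split=> [e | e].
    have gg : torus_coset g g by apply/cosetE.
    have coset_eq : torus_coset g = torus_coset h := congr1 sval e.
    by move: gg; rewrite coset_eq => /cosetE.
  apply: eq_exist; apply/seteqP.
  by split=> l /cosetE ql; apply/cosetE; rewrite ql.
have phi_q g : phi (q g) = SL2modT_pi g by apply/pi_eq; rewrite repK.
have pull (V : set (SL2modT k)) : q @^-1` (phi @^-1` V) = @SL2modT_pi k @^-1` V.
  by apply/seteqP; split=> g; rewrite /= phi_q.
have pullf (f : SL2modT k -> k) : (f \o phi) \o q = f \o @SL2modT_pi k.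
  by apply/funext => g /=; rewrite phi_q.
exists phi; split.
- have lift (C : SL2modT k) : exists g, SL2modT_pi g = C.
    by case: C => C [g defC]; exists g; apply: eq_exist.
  exists (fun C => q (sval (cid (lift C)))) => [t|C].
    by case: cid => g /= /pi_eq ->; rewrite repK.
  by case: cid => g /= <-; rewrite phi_q.
- move=> V; have := split_open q_split (phi @^-1` V); rewrite pull.
  exact: iff_sym.
- move=> V f _; have := split_regular q_split (phi @^-1` V) (f \o phi).
  by rewrite pull pullf => reg; exact: iff_sym.
Qed.

(** * The quadric as a quotient of SL_2 *)

Definition mx22 (T : Type) (a b c d : T) : 'M[T]_2 :=
  \matrix_(i, j) nth a (nth [::] [:: [:: a; b]; [:: c; d]] i) j.

Lemma det_mx22 (k : comNzRingType) (g : 'M[k]_2) :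
  \det g = g 0 0 * g 1 1 - g 0 1 * g 1 0.
Proof.
rewrite (expand_det_row g 0) !big_ord_recl big_ord0 addr0 /cofactor.
rewrite !det_mx11 !mxE /= !expr1 expr0 mul1r mulN1r mulrN.
by congr (_ * g _ _ - g _ _ * g _ _); apply: val_inj.
Qed.

Lemma ord2E (i : 'I_2) : (i = 0) \/ (i = 1).
Proof. by case: i => [[|[|//]] lti]; [left | right]; apply: val_inj. Qed.

(** The two expressions are the off-diagonal entries of g^-1 h, for g and h with
    rows (a, b), (c, d) and (a', b'), (c', d').  Multiplied by the entries of a
    column of h they vanish, and the entries of h generate the unit ideal. *)
Lemma same_products_minors (k : comNzRingType) (a b c d a' b' c' d' : k) :
  a' * d' - b' * c' = 1 ->
  a' * b' = a * b -> a' * d' = a * d -> b' * c' = b * c -> c' * d' = c * d ->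
  d * b' - b * d' = 0 /\ a * c' - c * a' = 0.
Proof.
move=> det1 ab ad bc cd; split; rewrite -[LHS]mulr1 -det1.
  have -> : (d * b' - b * d') * (a' * d' - b' * c') =
      d' * (d * (a' * b') - b * (a' * d')) - b' * (d * (b' * c') - b * (c' * d')).
    by ring.
  by rewrite ab ad bc cd; ring.
have -> : (a * c' - c * a') * (a' * d' - b' * c') =
    a' * (a * (c' * d') - c * (a' * d')) - c' * (a * (b' * c') - c * (a' * b')).
  by ring.
by rewrite ab ad bc cd; ring.
Qed.

Section QuadricQuotient.
Variables (k : fieldType) (c lam : k).
Hypotheses (two0 : 2 != 0 :> k) (lam0 : lam != 0) (lam2 : lam ^+ 2 = - (4 * c)).

Definition to_SL2 (g : 'M[k]_2) : SL2 k :=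
  insubd (exist (fun h : 'M[k]_2 => \det h == 1) 1%:M (introT eqP (det1 _ _))) g.

Lemma to_SL2K (g : 'M[k]_2) : \det g = 1 -> val (to_SL2 g) = g.
Proof. by move=> g1; rewrite /to_SL2 val_insubd g1 eqxx. Qed.

Lemma det_SL2 (g : SL2 k) : val g 0 0 * val g 1 1 - val g 0 1 * val g 1 0 = 1.
Proof. by rewrite -det_mx22; exact: eqP (valP g). Qed.

(** The factor lam, with lam^2 = -4c, moves the quadric of the invariants to
    the level c of p. *)
Definition quadric_inv (g : 'M[k]_2) : 'rV[k]_3 :=
  \row_i nth 0 [:: lam * (g 0 0 * g 0 1);
                  lam * ((g 0 0 * g 1 1 + g 0 1 * g 1 0) / 2);
                  lam * (g 1 0 * g 1 1)] i.

Lemma level_lam : c = - (lam / 2) ^+ 2.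
Proof.
have e4 : 2 ^+ 2 = 4 :> k by rewrite -natrX.
have four0 : 4 != 0 :> k by rewrite -e4 expf_neq0.
by rewrite expr_div_n lam2 mulNr opprK e4 mulrAC divff ?mul1r.
Qed.

Lemma quadric_inv_fiber (g : SL2 k) : (p k).@[quadric_inv (val g) 0] == c.
Proof.
rewrite eval_p !mxE /= level_lam; apply/eqP.
transitivity (- (lam / 2 * (val g 0 0 * val g 1 1 - val g 0 1 * val g 1 0)) ^+ 2).
  by field; rewrite two0.
by rewrite det_SL2 mulr1.
Qed.

Definition quadric_quot (g : SL2 k) : fiber_points (p k) c :=
  exist _ (quadric_inv (val g)) (quadric_inv_fiber g).

(** The sum ad + bc and the determinant ad - bc = 1 determine ad and bc. *)
Lemma quadric_quotP (g h : SL2 k) : quadric_quot h = quadric_quot g <->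
  [/\ val h 0 0 * val h 0 1 = val g 0 0 * val g 0 1,
      val h 0 0 * val h 1 1 = val g 0 0 * val g 1 1,
      val h 0 1 * val h 1 0 = val g 0 1 * val g 1 0 &
      val h 1 0 * val h 1 1 = val g 1 0 * val g 1 1].
Proof.
split=> [/(congr1 val) /= /rowP e|[e1 e2 e3 e4]]; last first.
  by apply: val_inj => /=; rewrite /quadric_inv e1 e2 e3 e4.
have e1 := e 0; have e2 := e 1; have e3 := e 2; rewrite !mxE /= in e1 e2 e3.
move/(mulfI lam0): e1 => e1; move/(mulfI lam0): e3 => e3.
move/(mulfI lam0)/(mulIf (invr_neq0 two0)): e2 => e2.
have half (a b a' b' : k) : a + b = a' + b' -> a - b = a' - b' -> a = a'.
  move=> eD eB; apply: (mulfI two0).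
  have twice (u w : k) : 2 * u = (u + w) + (u - w) by ring.
  by rewrite (twice a b) (twice a' b') eD eB.
have e4 : val h 0 0 * val h 1 1 = val g 0 0 * val g 1 1.
  by apply: half e2 _; rewrite !det_SL2.
by split => //; apply: (addrI (val g 0 0 * val g 1 1)); rewrite -e2 e4.
Qed.

Lemma quadric_quot_coset g h :
  torus_coset g h <-> quadric_quot h = quadric_quot g.
Proof.
split=> [[t t_diag def_h] | /quadric_quotP[e1 e2 e3 e4]].
  have t01 : val t 0 1 = 0 by move/is_diag_mxP: t_diag => ->.
  have t10 : val t 1 0 = 0 by move/is_diag_mxP: t_diag => ->.
  have t1 := det_SL2 t; rewrite t01 mul0r subr0 in t1.
  have hE i : val h i 0 = val g i 0 * val t 0 0 /\ val h i 1 = val g i 1 * val t 1 1.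
    rewrite def_h !mxE !big_ord_recl !big_ord0 /=.
    have -> : lift ord0 ord0 = 1 :> 'I_2 by apply: val_inj.
    by rewrite t01 t10 !mulr0 !addr0 add0r.
  apply/quadric_quotP; rewrite !(hE _).1 !(hE _).2.
  by split; rewrite mulrACA ?t1 ?[val t 1 1 * _]mulrC ?t1 mulr1.
(* t is g^-1 h. *)
pose t := mx22 (val g 1 1 * val h 0 0 - val g 0 1 * val h 1 0)
               (val g 1 1 * val h 0 1 - val g 0 1 * val h 1 1)
               (val g 0 0 * val h 1 0 - val g 1 0 * val h 0 0)
               (val g 0 0 * val h 1 1 - val g 1 0 * val h 0 1).
have dg := det_SL2 g; have dh := det_SL2 h.
have [t01 t10] := same_products_minors dh e1 e2 e3 e4.
have gt : val h = val g *m t.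
  apply/matrixP => i j; rewrite mxE !big_ord_recl big_ord0 !mxE addr0 /=.
  have -> : lift ord0 ord0 = 1 :> 'I_2 by apply: val_inj.
  transitivity (val h i j * (val g 0 0 * val g 1 1 - val g 0 1 * val g 1 0)).
    by rewrite dg mulr1.
  by case: (ord2E i) => ->; case: (ord2E j) => -> /=; ring.
have dt : \det t = 1.
  by move: (eqP (valP h)); rewrite gt det_mulmx (eqP (valP g)) mul1r.
exists (to_SL2 t); rewrite ?to_SL2K //=.
apply/is_diag_mxP => i j; rewrite to_SL2K // mxE.
by case: (ord2E i) => ->; case: (ord2E j) => ->.
Qed.

Lemma rational_to_SL2 (T : Type) (n : nat) (iota : T -> 'rV[k]_n)
    (b : {mpoly k[n]}) (u : T -> SL2 k) (e : 'M[{mpoly k[n]}]_2) :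
  (forall t, b.@[iota t 0] != 0 ->
    forall i j, val (u t) i j = (e i j).@[iota t 0] / b.@[iota t 0]) ->
  rational_on iota (fun g : SL2 k => mxvec (val g)) b u.
Proof.
move=> eE; exists (fun l => mxvec e 0 l) => t bt0 l.
by case/mxvec_indexP: l => i j; rewrite !mxvecE eE.
Qed.

(** On the fibre p = c the invariants ad and bc are y / lam + 1/2 and
    y / lam - 1/2. *)
Lemma quadric_quot_mx22 (v : fiber_points (p k) c) (a b e f : k) :
  lam * (a * b) = val v 0 0 -> lam * (e * f) = val v 0 2 ->
  a * f = val v 0 1 / lam + 2^-1 -> b * e = val v 0 1 / lam - 2^-1 ->
  val (to_SL2 (mx22 a b e f)) = mx22 a b e f /\
  quadric_quot (to_SL2 (mx22 a b e f)) = v.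
Proof.
move=> e0 e2 eaf ebe.
have half1 : 2^-1 + 2^-1 = 1 :> k by rewrite -mulr2n -(mulr_natl 2^-1 2) divff.
have det1 : \det (mx22 a b e f) = 1.
  rewrite det_mx22 !mxE /= eaf ebe opprB [2^-1 - _]addrC.
  by rewrite addrACA subrr add0r half1.
split; first exact: to_SL2K.
apply: val_inj; apply/rowP => j; rewrite /= to_SL2K // !mxE /=.
case: j => [[|[|[|//]]] lti] /=; rewrite ?e0 ?e2 ?eaf ?ebe.
- by congr (val v _ _); apply: val_inj.
- have -> (u w : k) : u + w + (u - w) = u * 2 by ring.
  rewrite mulfK // mulrC divfK //.
  by congr (val v _ _); apply: val_inj.
- by congr (val v _ _); apply: val_inj.
Qed.

Lemma fiber_products (v : fiber_points (p k) c) :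
  val v 0 0 / lam * (val v 0 2 / lam) =
  (val v 0 1 / lam + 2^-1) * (val v 0 1 / lam - 2^-1).
Proof.
have /eqP := valP v; rewrite eval_p.
move: (val v 0 0) (val v 0 1) (val v 0 2) => a b e.
rewrite level_lam => /eqP.
rewrite subr_eq => /eqP xz; rewrite mulf_div xz.
by field; rewrite two0 lam0.
Qed.

(** With al = ad and be = bc as functions on the surface, the sections are the
    matrices with rows (1, x / lam), (z / (lam al), al) where al <> 0, and
    (x / lam, 1), (be, z / (lam be)) where be <> 0.  As al - be = 1 the two
    open sets cover the surface. *)
Lemma quadric_quot_split :
  locally_split (fun g : SL2 k => mxvec (val g))
                (fun v : fiber_points (p k) c => val v) quadric_quot.
Proof.
split.
  pose e i j : {mpoly k[2 * 2]} := 'X_(mxvec_index i j).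
  exists (fun j => lam%:MP * nth 0 [:: e 0 0 * e 0 1;
     (e 0 0 * e 1 1 + e 0 1 * e 1 0) * 2^-1%:MP; e 1 0 * e 1 1] j) => g _ j.
  rewrite meval1 divr1 !mxE mevalM mevalC.
  case: j => [[|[|[|//]]] lti] /=.
  - by rewrite mevalM !mevalXU !mxvecE.
  - by rewrite mevalM mevalD !mevalM mevalC !mevalXU !mxvecE.
  - by rewrite mevalM !mevalXU !mxvecE.
pose X := (x k) * (lam^-1)%:MP; pose Z := z k * (lam^-1)%:MP.
pose al : {mpoly k[3]} := y k * (lam^-1)%:MP + (2^-1)%:MP.
pose be : {mpoly k[3]} := y k * (lam^-1)%:MP - (2^-1)%:MP.
pose fib := fiber_points (p k) c.
have XE (t : fib) : X.@[val t 0] = val t 0 0 / lam.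
  by rewrite mevalM mevalC mevalXU.
have ZE (t : fib) : Z.@[val t 0] = val t 0 2 / lam.
  by rewrite mevalM mevalC mevalXU.
have alE (t : fib) : al.@[val t 0] = val t 0 1 / lam + 2^-1.
  by rewrite mevalD mevalM !mevalC mevalXU.
have beE (t : fib) : be.@[val t 0] = val t 0 1 / lam - 2^-1.
  by rewrite mevalB mevalM !mevalC mevalXU.
have lamK (a : k) : lam * (a / lam) = a by rewrite mulrC divfK.
move=> v; have [al0|al0] := eqVneq al.@[val v 0] 0; last first.
  pose u (t : fib) := to_SL2
    (mx22 1 (val t 0 0 / lam) (val t 0 2 / lam / al.@[val t 0]) al.@[val t 0]).
  have u_sec (t : fib) : al.@[val t 0] != 0 ->
      val (u t) = mx22 1 (val t 0 0 / lam) (val t 0 2 / lam / al.@[val t 0])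
                       al.@[val t 0] /\ quadric_quot (u t) = t.
    move=> t0; apply: quadric_quot_mx22.
    - by rewrite mul1r lamK.
    - by rewrite divfK ?lamK.
    - by rewrite mul1r alE.
    - by rewrite mulrA fiber_products -alE mulrAC divff ?mul1r.
  exists al, u; split=> // [|t t0]; last exact: (u_sec t t0).2.
  apply: (@rational_to_SL2 _ _ _ _ _ (mx22 al (X * al) Z (al * al))) => t t0 i j.
  rewrite (u_sec t t0).1 !mxE.
  case: (ord2E i) => ->; case: (ord2E j) => -> /=.
  - by rewrite divff.
  - by rewrite mevalM mulfK ?XE.
  - by rewrite ZE.
  - by rewrite mevalM mulfK.
have be0 : be.@[val v 0] != 0.
  have -> : be.@[val v 0] = - 1.
    rewrite beE -[RHS]addr0 -al0 alE -[in RHS](divff two0); field.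
    by rewrite two0 lam0.
  by rewrite oppr_eq0 oner_eq0.
pose u (t : fib) := to_SL2
  (mx22 (val t 0 0 / lam) 1 be.@[val t 0]
        (val t 0 2 / lam / be.@[val t 0])).
have u_sec (t : fib) : be.@[val t 0] != 0 ->
    val (u t) = mx22 (val t 0 0 / lam) 1 be.@[val t 0]
        (val t 0 2 / lam / be.@[val t 0]) /\ quadric_quot (u t) = t.
  move=> t0; apply: quadric_quot_mx22.
  - by rewrite mulr1 lamK.
  - by rewrite (mulrC be.@[_]) divfK ?lamK.
  - by rewrite mulrA fiber_products -beE mulfK // alE.
  - by rewrite mul1r beE.
exists be, u; split=> // [|t t0]; last exact: (u_sec t t0).2.
apply: (@rational_to_SL2 _ _ _ _ _ (mx22 (X * be) be (be * be) Z)) => t t0 i j.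
rewrite (u_sec t t0).1 !mxE.
case: (ord2E i) => ->; case: (ord2E j) => -> /=.
- by rewrite mevalM mulfK ?XE.
- by rewrite divff.
- by rewrite mevalM mulfK.
- by rewrite ZE.
Qed.
End QuadricQuotient.

Lemma quadric_isomorphic (k : closedFieldType) (c : k) :
  [pchar k] =i pred0 -> c != 0 ->
  isomorphic (fiber_space (p k) c) (SL2modT_space k).
Proof.
move=> char0 c0; have [lam lam2] := exists_sqrt (- (4 * c)).
have two0 : 2 != 0 :> k := char0_natr_neq0 1 char0.
have lam0 : lam != 0.
  by rewrite -sqrf_eq0 lam2 oppr_eq0 mulf_neq0 // char0_natr_neq0.
apply: (split_isomorphic_SL2modT (quadric_quot_split two0 lam0 lam2)).
exact: quadric_quot_coset.
Qed.

(** * The fibres of G *)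

Definition poly_map (k : fieldType) (m n : nat) (t : n.-tuple {mpoly k[m]})
    (v : 'rV[k]_m) : 'rV[k]_n := \row_i (tnth t i).@[v 0].

Lemma eval_poly_map (k : fieldType) (m n : nat) (t : n.-tuple {mpoly k[m]})
    (f : {mpoly k[n]}) v : f.@[poly_map t v 0] = (f \mPo t).@[v 0].
Proof. by rewrite comp_mpoly_meval; apply: meval_eq => i; rewrite mxE. Qed.

Lemma comp_mpoly_mod (k : fieldType) (m : nat) (s : m.-tuple {mpoly k[m]})
    (d f : {mpoly k[m]}) :
  (forall i, rdvd d (tnth s i - 'X_i)) -> rdvd d (f \mPo s - f).
Proof.
move=> sX; elim/mpoly_ring_ind: f => [a|i|f g [u fE] [v gE]|f g [u fE] [v gE]].
- by exists 0; rewrite comp_mpolyC subrr mul0r.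
- by rewrite comp_mpolyXU -tnth_nth.
- by exists (u + v); rewrite mulrDl -fE -gE comp_mpolyD opprD addrACA.
exists (u * g + (f \mPo s) * v).
by rewrite mulrDl mulrAC -fE -mulrA -gE rmorphM mulrBl mulrBr [RHS]addrC subrKA.
Qed.

Lemma comp_mpolyA (k : fieldType) (l m n : nat) (s : m.-tuple {mpoly k[l]})
    (t : n.-tuple {mpoly k[m]}) (f : {mpoly k[n]}) :
  (f \mPo t) \mPo s = f \mPo [tuple of map (comp_mpoly s) t].
Proof.
elim/mpoly_ring_ind: f => [a|i|f g fE gE|f g fE gE].
- by rewrite !comp_mpolyC.
- by rewrite !comp_mpolyXU -!tnth_nth tnth_map.
- by rewrite !comp_mpolyD fE gE.
- by rewrite !rmorphM /= fE gE.
Qed.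

(** A polynomial with a power in the ideal of the fibre vanishes on the fibre. *)
Lemma reduced_of_vanishing (k : fieldType) (n : nat) (f : {mpoly k[n]}) (c : k) :
  (forall g : {mpoly k[n]},
     (forall v : 'rV[k]_n, f.@[v 0] = c -> g.@[v 0] = 0) -> fiber_ideal f c g) ->
  fiber_reduced f c.
Proof.
move=> null g m [h gm]; apply: null => v fv.
have := congr1 (meval (v 0)) gm; rewrite rmorphXn mevalM mevalB mevalC fv subrr mulr0.
by move/eqP; rewrite expf_eq0 => /andP[_ /eqP].
Qed.

(** Division of F^4 + r^3 by x leaves F V - r^2.  The other two identities are
    the analogues for y and z: a polynomial of (F, r, V) that is the coordinate
    times a power of G. *)
Lemma pullback_identities (T : comNzRingType) (x y z : T) :
  let F := x * z - y ^+ 3 in let r := y * F - x in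
  let V := z * F ^+ 2 - 2 * y ^+ 2 * F + x * y in let G := F * V - r ^+ 2 in
  [/\ F ^+ 4 + r ^+ 3 = x * G, F ^+ 3 + r * V = y * G &
      F ^+ 5 + 3 * F ^+ 2 * r * V - F * r ^+ 3 + V ^+ 3 = z * G ^+ 2].
Proof. by move=> F r V G; split; rewrite /G /V /r /F; ring. Qed.

Section Maps.
Variables (k : fieldType) (c : k).

Definition vcoord : {mpoly k[3]} := z k * F k ^+ 2 - 2 * y k ^+ 2 * F k + x k * y k.

Definition to_quadric : 3.-tuple {mpoly k[3]} := [tuple F k; r k; vcoord].

(** The inverse of [to_quadric] on the fibre over c, read off from
    [pullback_identities] with G = c. *)
Definition from_quadric : 3.-tuple {mpoly k[3]} :=
  [tuple c^-1 *: (x k ^+ 4 + y k ^+ 3); c^-1 *: (x k ^+ 3 + y k * z k);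
         c^-2 *: (x k ^+ 5 + 3 * x k ^+ 2 * y k * z k - x k * y k ^+ 3 + z k ^+ 3)].
End Maps.

Section GFibers.
Variables (k : closedFieldType) (G : {mpoly k[3]}).
Hypothesis def_G : x k * G = F k ^+ 4 + r k ^+ 3.

Local Notation to_quadric := (to_quadric k).
Local Notation vcoord := (vcoord k).

Lemma x_neq0 : x k != 0.
Proof.
apply/eqP => /(congr1 (meval (fun=> 1))) /eqP.
by rewrite mevalXU meval0 oner_eq0.
Qed.

Lemma G_def : G = F k * vcoord - r k ^+ 2.
Proof.
apply: (mulfI x_neq0); rewrite def_G.
by have [-> _ _] := pullback_identities (x k) (y k) (z k).
Qed.

Lemma p_to_quadric : p k \mPo to_quadric = G.
Proof.
by rewrite G_def /p /x /y /z rmorphB rmorphM rmorphXn /= !comp_mpolyXU.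
Qed.

Variable c : k.
Hypothesis c0 : c != 0.

Local Notation from_quadric := (from_quadric c).

Lemma from_to_quadric : [tuple of map (comp_mpoly to_quadric) from_quadric] =
  [tuple c^-1 *: (x k * G); c^-1 *: (y k * G); c^-2 *: (z k * G ^+ 2)].
Proof.
have [e1 e2 e3] := pullback_identities (x k) (y k) (z k).
rewrite -/(F k) -/(r k) -/vcoord -G_def in e1 e2 e3.
apply: val_inj; rewrite /= !linearZ /= -e1 -e2 -e3.
rewrite !(rmorphD, rmorphN, rmorphM, rmorphXn, rmorph1) /=.
by rewrite /x /y /z !comp_mpolyXU.
Qed.

(** The composite substitution is x G / c, y G / c, z (G / c)^2, congruent to the
    identity modulo G - c. *)
Lemma from_to_quadric_mod (f : {mpoly k[3]}) :
  rdvd (G - c%:MP) ((f \mPo from_quadric) \mPo to_quadric - f).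
Proof.
have scale1 (g : {mpoly k[3]}) : rdvd (G - c%:MP) (c^-1 *: (g * G) - g).
  exists (c^-1 *: g).
  rewrite -scalerAl mulrBr scalerBr [g * c%:MP]mulrC mul_mpolyC scalerA.
  by rewrite mulVf ?scale1r.
rewrite comp_mpolyA; apply: comp_mpoly_mod; rewrite from_to_quadric => i.
case: i => [[|[|[|//]]] lti]; rewrite (tnth_nth 0) /=.
- by have := scale1 (x k); rewrite /x; congr (rdvd _ (_ - 'X__)); apply: val_inj.
- by have := scale1 (y k); rewrite /y; congr (rdvd _ (_ - 'X__)); apply: val_inj.
have -> : 'X_(Ordinal lti) = z k by rewrite /z; congr 'X__; apply: val_inj.
have := rdvdD (scale1 (c^-1 *: (z k * G))) (scale1 (z k)).
by rewrite subrKA -scalerAl scalerA -invfM -mulrA.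
Qed.

Lemma to_quadric_fiber (v : 'rV[k]_3) :
  G.@[v 0] = c -> (p k).@[poly_map to_quadric v 0] = c.
Proof. by rewrite eval_poly_map p_to_quadric. Qed.

Lemma from_to_quadric_point (v : 'rV[k]_3) : G.@[v 0] = c ->
  poly_map from_quadric (poly_map to_quadric v) = v.
Proof.
move=> Gv; apply/rowP => i; rewrite mxE.
have [h] := from_to_quadric_mod 'X_i => /(congr1 (meval (v 0))).
rewrite mevalM !mevalB mevalC Gv subrr mulr0 -!eval_poly_map !mevalXU.
by move=> /eqP; rewrite subr_eq0 mxE => /eqP.
Qed.

Lemma to_from_quadric_point (w : 'rV[k]_3) : (p k).@[w 0] = c ->
  poly_map to_quadric (poly_map from_quadric w) = w.
Proof.
rewrite eval_p; move: c0 => c0'; set a := w 0 0; set b := w 0 1; set v := w 0 2.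
(* With c replaced by av - b^2 these are identities of rational functions. *)
move=> pw; rewrite -pw in c0'.
have imE : [/\ poly_map from_quadric w 0 0 = (a ^+ 4 + b ^+ 3) / c,
    poly_map from_quadric w 0 1 = (a ^+ 3 + b * v) / c &
    poly_map from_quadric w 0 2 =
      (a ^+ 5 + 3 * a ^+ 2 * b * v - a * b ^+ 3 + v ^+ 3) / c ^+ 2].
  have three : (3 : {mpoly k[3]}).@[w 0] = 3 by rewrite rmorph_nat.
  split; rewrite mxE (tnth_nth 0) /= mevalZ mulrC ?exprVn; congr (_ / _).
  - by rewrite mevalD !rmorphXn /= /x /y !mevalXU.
  - by rewrite mevalD rmorphXn mevalM /= /x /y /z !mevalXU.
  - by rewrite /x /y /z mevalD mevalB mevalD !mevalM three !mevalXU.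
have [e0 e1 e2] := imE.
have FE : (F k).@[poly_map from_quadric w 0] = a.
  rewrite /F /x /y /z mevalB mevalM rmorphXn /= !mevalXU e0 e1 e2 -pw.
  by field.
have rE : (r k).@[poly_map from_quadric w 0] = b.
  rewrite /r mevalB mevalM FE /x /y !mevalXU e0 e1 -pw.
  by field.
have VE : vcoord.@[poly_map from_quadric w 0] = v.
  rewrite /vcoord.
  move: (F k) FE => f FE.
  have two : (2 : {mpoly k[3]}).@[poly_map from_quadric w 0] = 2 by rewrite rmorph_nat.
  rewrite /x /y /z mevalD mevalB !mevalM two FE !mevalXU e0 e1 e2 -pw.
  by field.
apply/rowP => j; rewrite mxE (tnth_nth 0).
case: j => [[|[|[|//]]] lti] /=.
- by rewrite FE /a; congr (w _ _); apply: val_inj.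
- by rewrite rE /b; congr (w _ _); apply: val_inj.
- by rewrite VE /v; congr (w _ _); apply: val_inj.
Qed.

Lemma from_quadric_fiber (w : 'rV[k]_3) :
  (p k).@[w 0] = c -> G.@[poly_map from_quadric w 0] = c.
Proof.
by move=> pw; rewrite -p_to_quadric -eval_poly_map to_from_quadric_point.
Qed.

(** Transport of the Nullstellensatz along [from_quadric]: f (from_quadric) is a
    multiple of p - c, so its pullback by [to_quadric], which is f modulo G - c,
    is a multiple of G - c. *)
Lemma G_nullstellensatz (f : {mpoly k[3]}) : [pchar k] =i pred0 ->
  (forall v : 'rV[k]_3, G.@[v 0] = c -> f.@[v 0] = 0) -> fiber_ideal G c f.
Proof.
move=> char0 f0.
have [|h def_h] := @quadric_nullstellensatz k c (f \mPo from_quadric) char0.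
  by move=> w pw; rewrite -eval_poly_map f0 // from_quadric_fiber.
have [e def_e] := from_to_quadric_mod f; exists (h \mPo to_quadric - e).
rewrite mulrBl -def_e def_h rmorphM /= comp_mpolyB p_to_quadric comp_mpolyC.
by rewrite subKr.
Qed.

Definition to_quadric_points (v : fiber_points G c) : fiber_points (p k) c :=
  exist _ (poly_map to_quadric (val v)) (introT eqP (to_quadric_fiber (eqP (valP v)))).
Definition from_quadric_points (w : fiber_points (p k) c) : fiber_points G c :=
  exist _ (poly_map from_quadric (val w)) (introT eqP (from_quadric_fiber (eqP (valP w)))).

Lemma G_isomorphic_quadric : isomorphic (fiber_space G c) (fiber_space (p k) c).
Proof.
have to_quadricK : cancel to_quadric_points from_quadric_points.
  by move=> v; apply: val_inj; rewrite /= from_to_quadric_point // (eqP (valP v)).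
have from_quadricK : cancel from_quadric_points to_quadric_points.
  by move=> w; apply: val_inj; rewrite /= to_from_quadric_point // (eqP (valP w)).
apply: (@split_isomorphic _ _ _ _ _ _ _ to_quadric_points).
  by exists from_quadric_points.
split=> [|w].
  by exists (tnth to_quadric) => v _ j; rewrite meval1 divr1 mxE.
exists 1, from_quadric_points; split=> [||t _]; first by rewrite meval1 oner_eq0.
  by exists (tnth from_quadric) => v _ j; rewrite meval1 divr1 mxE.
exact: from_quadricK.
Qed.
End GFibers.

(** * The zero fibre of G *)

Section PreimagePrime.
Variables (R R' : comNzRingType) (th : {rmorphism R -> R'}) (P : prime_idealr R').

Definition prime_preim : R -> bool := fun a => th a \in (P : pred R').

Lemma prime_preim_ideal : idealr_closed prime_preim.
Proof.
split.
- by rewrite unfold_in /prime_preim rmorph0; exact: idealr0.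
- by rewrite unfold_in /prime_preim rmorph1 idealr1.
move=> a u v uP vP; have : th a * th u + th v \in (P : pred R').
  by rewrite rpredD // idealMr.
by rewrite -rmorphM -rmorphD.
Qed.
HB.instance Definition _ := isIdealr.Build R prime_preim prime_preim_ideal.

Lemma prime_preim_prime : prime_idealr_closed prime_preim.
Proof.
move=> u v uvP; have : th u * th v \in (P : pred R') by rewrite -rmorphM.
by rewrite prime_idealrM.
Qed.
HB.instance Definition _ := isPrimeIdealrClosed.Build R prime_preim prime_preim_prime.
End PreimagePrime.

Section KernelPrime.
Variables (R : comNzRingType) (D : idomainType) (th : {rmorphism R -> D}).

Definition kernel : R -> bool := fun a => th a == 0.

Lemma kernel_ideal : idealr_closed kernel.
Proof.
split; rewrite ?unfold_in /kernel ?rmorph0 ?rmorph1 ?oner_eq0 //.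
move=> a u v; rewrite !unfold_in /kernel rmorphD rmorphM => /eqP -> /eqP ->.
by rewrite mulr0 addr0.
Qed.
HB.instance Definition _ := isIdealr.Build R kernel kernel_ideal.

Lemma kernel_prime : prime_idealr_closed kernel.
Proof. by move=> u v; rewrite !unfold_in /kernel rmorphM mulf_eq0. Qed.
HB.instance Definition _ := isPrimeIdealrClosed.Build R kernel kernel_prime.
End KernelPrime.

Lemma normal_quotient_iso (R R' : comNzRingType) (I : set R) (I' : set R')
    (th : {rmorphism R -> R'}) (th' : {rmorphism R' -> R}) :
  cancel th th' -> cancel th' th -> (forall a, I a <-> I' (th a)) ->
  normal_quotient I -> normal_quotient I'.
Proof.
move=> thK thK' II' normI P I'P.
have [a Ia|B [rho [[unit_rho repr_rho ker_rho] intB]]] := normI (prime_preim th P).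
  by rewrite unfold_in; apply/I'P/II'.
have notP s : (s \notin (P : pred R')) = (th' s \notin prime_preim th P).
  by rewrite [in RHS]unfold_in /prime_preim thK'.
exists B, (rho \o th'); split => //; split=> [s|b|a].
- by rewrite notP => /unit_rho.
- have [a [s [sP ->]]] := repr_rho b; exists (th a), (th s).
  by rewrite notP /= !thK.
split=> [/ker_rho[s sP /II' sa]|[s sP sa]].
  by exists (th s); [rewrite notP thK | rewrite rmorphM thK' in sa].
by apply/ker_rho; exists (th' s); rewrite -?notP //; apply/II'; rewrite rmorphM !thK'.
Qed.

Lemma cubic_of_quartic (K : fieldType) (a b : K) :
  b != 0 -> b ^+ 4 + a ^+ 3 = 0 -> (a / b) ^+ 3 + b = 0.
Proof.
move=> b0 e; have -> : (a / b) ^+ 3 + b = (b ^+ 4 + a ^+ 3) / b ^+ 3 by field.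
by rewrite e mul0r.
Qed.

Section NotNormal.
Variables (k : closedFieldType) (G : {mpoly k[3]}).
Hypothesis def_G : x k * G = F k ^+ 4 + r k ^+ 3.

(* Restriction to the axis x = y = 0; the default value of nth is the image
   of z. *)
Definition to_axis : {mpoly k[3]} -> {poly k} :=
  mmap (@polyC k) (fun i : 'I_3 => nth 'X [:: 0; 0] i).
HB.instance Definition _ := GRing.RMorphism.on to_axis.

(** Restriction to the curve x = xi t^4, y = t, z = z0.  The weights 4 and 1 of
    x and y make the lowest terms of r and G homogeneous. *)
Definition to_curve (xi z0 : k) : {mpoly k[3]} -> {poly k} :=
  mmap (@polyC k) (fun i : 'I_3 => nth z0%:P [:: xi *: 'X^4; 'X] i).
HB.instance Definition _ xi z0 := GRing.RMorphism.on (to_curve xi z0).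

Lemma to_curveX xi z0 : [/\ to_curve xi z0 (x k) = xi%:P * 'X^4,
  to_curve xi z0 (y k) = 'X & to_curve xi z0 (z k) = z0%:P].
Proof. by rewrite /to_curve /x /y /z !mmapX !mmap1U /= mul_polyC. Qed.

Lemma to_curve_coef0 xi z0 f : (to_curve xi z0 f)`_0 = (to_axis f).[z0].
Proof.
elim/mpoly_ring_ind: f => [a|i|f g fE gE|f g fE gE].
- by rewrite /to_curve /to_axis !mmapC coefC hornerC.
- rewrite /to_curve /to_axis !mmapX !mmap1U.
  case: i => [[|[|[|//]]] lti] /=; rewrite ?coefZ ?coefXn ?coefX ?coefC ?mulr0.
  + by rewrite horner0.
  + by rewrite horner0.
  + by rewrite hornerX.
- by rewrite !rmorphD /= coefD hornerD fE gE.
- by rewrite !rmorphM /= coef0M hornerM fE gE.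
Qed.

(** x has order 4 along the curve, so xi does not appear below t^4. *)
Lemma to_curve_coef1 xi z0 f : (to_curve xi z0 f)`_1 = (to_curve 0 z0 f)`_1.
Proof.
elim/mpoly_ring_ind: f => [a|i|f g fE gE|f g fE gE].
- by rewrite /to_curve !mmapC.
- rewrite /to_curve !mmapX !mmap1U.
  by case: i => [[|[|[|//]]] lti] /=; rewrite ?coefZ ?coefXn ?mulr0.
- by rewrite !rmorphD /= !coefD fE gE.
rewrite !rmorphM /= !coefM !big_ord_recl !big_ord0 /= fE gE.
by rewrite !to_curve_coef0.
Qed.

(** Along the curve F = t^3 (-1 + ..), r = t^4 (-1 - xi + ..), and G has order at
    least 8: compare the coefficients of t^3 and t^4. *)
Lemma curve_relation xi z0 s a h : s * r k - a * F k = h * G ->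
  (to_axis a).[z0] = 0 /\ (to_curve 0 z0 a)`_1 = (1 + xi) * (to_axis s).[z0].
Proof.
move=> /(congr1 (to_curve xi z0)); rewrite (G_def def_G) /vcoord.
have [xE yE zE] := to_curveX xi z0; pose X : {poly k} := 'X.
pose f1 : {poly k} := (xi * z0)%:P * X - 1; pose r1 := f1 - xi%:P.
pose v1 := z0%:P * X * f1 ^+ 2 - 2 * f1 + xi%:P.
have FE : to_curve xi z0 (F k) = X ^+ 3 * f1.
  rewrite /F rmorphB rmorphM rmorphXn /= xE yE zE /f1 polyCM -/X; ring.
have rE : to_curve xi z0 (r k) = X ^+ 4 * r1.
  rewrite /r rmorphB rmorphM /= xE yE FE /r1 -/X; ring.
move: (F k) (r k) (x k) (y k) (z k) FE rE xE yE zE => F' r' x' y' z' FE rE xE yE zE.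
rewrite !(rmorphB, rmorphM, rmorphD, rmorphXn) /= FE rE xE yE zE ?rmorph1 -/X.
set S := to_curve xi z0 s; set A := to_curve xi z0 a; set H := to_curve xi z0 h.
move=> rel; have {}rel : S * r1 * X - A * f1 = H * (f1 * v1 - r1 ^+ 2) * X ^+ 5.
  have X30 : X ^+ 3 != 0 by rewrite expf_neq0 ?polyX_eq0.
  apply: (mulfI X30); transitivity (S * (X ^+ 4 * r1) - A * (X ^+ 3 * f1)); first by ring.
  rewrite rel /v1; ring.
have f10 : f1`_0 = -1 by rewrite coefB coefMX coef1 sub0r.
have A0 : A`_0 = 0.
  have := congr1 (fun q : {poly k} => q`_0) rel.
  rewrite coefB coefMX /= coefMXn /= coef0M f10 sub0r mulrN1 opprK //.
have := congr1 (fun q : {poly k} => q`_1) rel.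
rewrite coefB coefMX /= coefMXn /= coef0M coefM !big_ord_recl big_ord0 /=.
rewrite A0 mul0r add0r addr0 -[bump 0 0]/1%N subnn f10 coefB f10 coefC /=.
rewrite mulrN1 opprK => A1.
rewrite -(to_curve_coef0 xi) -/A A0 -(to_curve_coef1 xi) -(to_curve_coef0 xi) -/A -/S.
by split=> //; apply: (addrI (S`_0 * (- 1 - xi))); rewrite A1; ring.
Qed.

(** The prime is the ideal of the axis x = y = 0.  In its local ring r/F is
    integral, and r/F = a/s would be a relation s r = a F modulo G, so that
    [curve_relation], for xi = 0 and xi = -1, makes s vanish on the axis. *)
Lemma G_not_normal : ~ fiber_normal G 0.
Proof.
move=> normG.
have axis s : s \notin kernel to_axis -> exists z0, (to_axis s).[z0] != 0.
  by rewrite unfold_in /kernel => /closed_nonrootP.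
have [a [h ->]|B [rho [[unit_rho repr_rho ker_rho] intB]]] := normG (kernel to_axis).
  rewrite unfold_in /kernel rmorphM /= mpolyC0 subr0.
  have [xE yE zE] : [/\ to_axis (x k) = 0, to_axis (y k) = 0 & to_axis (z k) = 'X].
    by rewrite /to_axis /x /y /z !mmapX !mmap1U.
  have FE : to_axis (F k) = 0.
    by rewrite /F rmorphB rmorphM rmorphXn /= xE yE mul0r expr0n subr0.
  have rE : to_axis (r k) = 0.
    by rewrite /r rmorphB rmorphM /= xE FE mulr0 subr0.
  have -> : to_axis G = 0; last by rewrite mulr0.
  rewrite (G_def def_G); move: (F k) (r k) FE rE => F' r' FE rE.
  by rewrite rmorphB rmorphM rmorphXn /= FE rE mul0r expr0n subr0.
have rhoF0 : rho (F k) != 0.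
  apply/eqP => /ker_rho[s /axis[z0 sz0] [h]]; rewrite mpolyC0 subr0 => sF.
  have [] := @curve_relation 0 z0 0 (- s) h.
    by rewrite mul0r sub0r mulNr opprK.
  by rewrite rmorphN hornerN => /eqP; rewrite oppr_eq0 (negbTE sz0).
have rhoF0' : tofrac (rho (F k)) != 0 by rewrite tofrac_eq0.
have rho_rel : rho (F k ^+ 4 + r k ^+ 3) = 0.
  rewrite -def_G; apply/ker_rho; exists 1.
    by rewrite unfold_in /kernel rmorph1 oner_eq0.
  by exists (x k); rewrite mul1r mpolyC0 subr0.
have [|b def_b] := intB (tofrac (rho (r k)) / tofrac (rho (F k))).
  exists ('X^3 + (rho (F k))%:P).
    by rewrite monicE lead_coefDl ?lead_coefXn // size_polyXn size_polyC; case: (_ != 0).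
  rewrite /root rmorphD /= map_polyXn map_polyC hornerD hornerXn hornerC.
  rewrite cubic_of_quartic // -!rmorphXn -!rmorphD /=.
  by rewrite rho_rel rmorph0.
have def_r : rho (r k) = b * rho (F k).
  by apply/eqP; rewrite -tofrac_eq tofracM -def_b divfK.
have [a [s [sP def_b']]] := repr_rho b.
have : rho (s * r k - a * F k) = 0.
  rewrite rmorphB !rmorphM def_r def_b' mulrA [rho s * _]mulrC divrK ?subrr //.
  exact: unit_rho.
move/ker_rho=> [s' s'P [h]]; rewrite mpolyC0 subr0 mulrBr !mulrA => rel.
have /axis[z0 sz0] : s' * s \notin kernel to_axis by rewrite prime_idealrM negb_or s'P.
have [_ e0] := curve_relation 0 z0 rel; have [_ e1] := curve_relation (- 1) z0 rel.
by move: sz0; rewrite -[X in X != 0]mul1r -{1}[1]addr0 -e0 e1 subrr mul0r eqxx.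
Qed.
End NotNormal.

(** * Automorphisms of affine space *)

Section Automorphism.
Variable k : closedFieldType.
Hypothesis char0 : [pchar k] =i pred0.
Local Notation R := {mpoly k[3]}.

Lemma exists_notin (L : seq k) : exists c, c \notin L.
Proof.
have /closed_nonrootP[c] : \prod_(a <- L) ('X - a%:P) != 0.
  by apply: monic_neq0; apply: monic_prod_XsubC.
by rewrite root_prod_XsubC; exists c.
Qed.

Lemma msize_quadric (c : k) : (1 < msize (p k - c%:MP))%N.
Proof.
rewrite ltnNge; apply/negP => /msize1_polyC; set a := _@_0 => pc.
pose e (b : k) : 'I_3 -> k := fun i => nth 0 [:: 0; b] i.
have ev b : - b ^+ 2 - c = a.
  have := congr1 (meval (e b)) pc; rewrite mevalC (mevalB _ (p k)) mevalC eval_p /e /=.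
  by rewrite mul0r sub0r.
have := ev 1; rewrite -(ev 0) expr0n oppr0 => /addIr /eqP.
by rewrite expr1n oppr_eq0 oner_eq0.
Qed.

(** A polynomial that vanishes at all points is divisible by p - c, and the
    quotient vanishes off p = c; repeating this with new values c would lower
    the degree forever.  The list L collects the values already used. *)
Lemma mpoly_vanish (f : R) : (forall v : 'rV[k]_3, f.@[v 0] = 0) -> f = 0.
Proof.
move=> f0; have : forall v : 'rV[k]_3, (p k).@[v 0] \notin [::] -> f.@[v 0] = 0 by [].
have [n] := ubnP (msize f); elim: n f [::] {f0} => // n IHn f L ltfn f0.
have [c cL] := exists_notin L.
have [|h def_f] := @quadric_nullstellensatz k c f char0.
  by move=> v pv; apply: f0; rewrite pv.
have [h0|h0] := eqVneq h 0; first by rewrite def_f h0 mul0r.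
have d0 : p k - c%:MP != 0.
  by rewrite -msize_poly_eq0 -lt0n (leq_trans _ (msize_quadric c)).
suff h00 : h = 0 by rewrite h00 eqxx in h0.
apply: (IHn h (c :: L)) => [|v].
  move: ltfn; rewrite def_f msizeM //; have := msize_quadric c.
  case: (msize (p k - c%:MP)) => [|[|m]] // _.
  by rewrite !addnS /= ltnS => /(leq_trans _) -> //; rewrite ltnS leq_addr.
rewrite inE negb_or => /andP[pv pvL]; have := f0 v pvL.
rewrite def_f mevalM (mevalB _ (p k)) mevalC => /eqP.
by rewrite mulf_eq0 subr_eq0 (negbTE pv) orbF => /eqP.
Qed.

Variable G : R.
Hypothesis def_G : x k * G = F k ^+ 4 + r k ^+ 3.

Lemma G_neq1 : G - 1%:MP != 0.
Proof.
apply/eqP => /(congr1 (meval (fun=> 0))) /eqP.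
have F0 : (F k).@[fun=> 0] = 0.
  by rewrite /F mevalB mevalM rmorphXn /= !mevalXU mul0r expr0n subr0.
have r0 : (r k).@[fun=> 0] = 0.
  by rewrite /r mevalB mevalM F0 /x mevalXU mulr0 subr0.
rewrite mevalB mevalC meval0 (G_def def_G); move: (F k) (r k) F0 r0 => F' r' F0 r0.
by rewrite mevalB mevalM rmorphXn /= F0 r0 mul0r expr0n !subr0 sub0r oppr_eq0 oner_eq0.
Qed.

(** With s and t the coordinate polynomials of f and its inverse, f pulls p - 1
    back to h (G - 1), and the inverse pulls G - 1 back to h' (p - 1); composing,
    h is a unit of the polynomial ring, that is, a nonzero constant l.  Hence f
    pulls p - (1 - l) back to l G. *)
Lemma no_automorphism : ~ exists f : 'rV[k]_3 -> 'rV[k]_3,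
  algebraic_automorphism f /\ f @` hypersurface G 1 = hypersurface (p k) 1.
Proof.
case=> f [[[P fE] [g [[Q gE] fK gK]]] f_im].
pose s : 3.-tuple R := [tuple P i | i < 3]; pose t : 3.-tuple R := [tuple Q i | i < 3].
have evals (v : 'rV[k]_3) (h : R) : (h \mPo s).@[v 0] = h.@[f v 0].
  rewrite -eval_poly_map fE; apply: meval_eq => i; rewrite !mxE.
  by rewrite tnth_mktuple.
have evalt (v : 'rV[k]_3) (h : R) : (h \mPo t).@[v 0] = h.@[g v 0].
  rewrite -eval_poly_map gE; apply: meval_eq => i; rewrite !mxE.
  by rewrite tnth_mktuple.
have stK : cancel (comp_mpoly t) (comp_mpoly s).
  move=> h; apply/eqP; rewrite -subr_eq0; apply/eqP/mpoly_vanish => v.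
  by rewrite mevalB evals evalt fK subrr.
have tsK : cancel (comp_mpoly s) (comp_mpoly t).
  move=> h; apply/eqP; rewrite -subr_eq0; apply/eqP/mpoly_vanish => v.
  by rewrite mevalB evalt evals gK subrr.
have [|h def_h] := @G_nullstellensatz k G def_G 1 (oner_neq0 _) (p k \mPo s - 1%:MP) char0.
  move=> v Gv; rewrite mevalB mevalC evals.
  have : hypersurface (p k) 1 (f v) by rewrite -f_im; exists v.
  by rewrite /hypersurface /= => ->; rewrite subrr.
have [|h' def_h'] := @quadric_nullstellensatz k 1 (G \mPo t - 1%:MP) char0.
  move=> w pw; rewrite mevalB mevalC evalt.
  have : (f @` hypersurface G 1) w by rewrite f_im.
  by case=> v Gv <-; rewrite fK Gv subrr.
have h'h : (h' \mPo s) * h = 1.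
  apply: (mulIf G_neq1); rewrite mul1r -mulrA -def_h.
  have := congr1 (comp_mpoly s) def_h'.
  by rewrite rmorphM /= !comp_mpolyB stK !comp_mpolyC => <-.
have [l l0 def_l] : exists2 l : k, l != 0 & h = l%:MP.
  have /andP[/eqP def_h0] := mpoly_intro_unit h'h.
  by rewrite unitfE => h0; exists h@_0%MM.
have def_p : p k \mPo s - (1 - l)%:MP = l%:MP * G.
  move: def_h; rewrite def_l mulrBr mpolyCB => e.
  by rewrite opprB addrA addrAC e -mpolyCM mulr1 subrK.
apply: (G_not_normal def_G).
have := @quadric_normal k (1 - l) char0.
apply: (@normal_quotient_iso R R _ _ (comp_mpoly s) (comp_mpoly t)) => // a.
split=> [[e ->]|[e def_e]].
  exists ((e \mPo s) * l%:MP); rewrite rmorphM /= comp_mpolyB comp_mpolyC def_p.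
  by rewrite mpolyC0 subr0 mulrA.
have tG : p k - (1 - l)%:MP = l%:MP * (G \mPo t).
  by have := congr1 (comp_mpoly t) def_p; rewrite rmorphM comp_mpolyB /= !comp_mpolyC tsK.
exists ((e \mPo t) * (l^-1)%:MP); rewrite tG mulrA -[_ * l%:MP]mulrA -mpolyCM mulVf //.
by rewrite mulr1 -[LHS]tsK def_e mpolyC0 subr0 rmorphM.
Qed.
End Automorphism.

Theorem theorem1p8 (k : closedFieldType) (char_k : [pchar k] =i pred0)
    (G : {mpoly k[3]}) (def_G : x k * G = F k ^+ 4 + r k ^+ 3) :
  [/\ forall c : k, c != 0 ->
        fiber_isomorphic_to (p k) c (SL2modT_space k) /\
        fiber_isomorphic_to G c (SL2modT_space k),
      forall c : k, fiber_normal (p k) c,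
      ~ fiber_normal G 0 &
      ~ exists phi : 'rV[k]_3 -> 'rV[k]_3,
          algebraic_automorphism phi /\
          phi @` hypersurface G 1 = hypersurface (p k) 1].
Proof.
split.
- move=> c c0; have iso_p := quadric_isomorphic char_k c0; split; split => //.
  + by apply: reduced_of_vanishing => g; apply: quadric_nullstellensatz.
  + by apply: reduced_of_vanishing => g; apply: G_nullstellensatz.
  + exact: isomorphic_trans (G_isomorphic_quadric def_G c0) iso_p.
- by move=> c; apply: quadric_normal.
- exact: G_not_normal.
- exact: no_automorphism.
Qed.
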